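(* Let $a,b,c,d$ be nonnegative integers with $d\le b\le c$. Then $$\frac{M(H_{2a,b,c;d})}{M(H_{2a,b,c})}=\prod_{k=0}^{d-1} \frac{(k+\frac{1}{2})_{b-2k}\,(a+k+1)_{b-2k-1}\,(b-k+\frac{1}{2})_{\lfloor\frac{c-b}{2}\rfloor}\,(c-k)_{-\lfloor\frac{c-b}{2}\rfloor}}{(a+k+\frac{1}{2})_{b-2k}\,(k+1)_{b-2k-1}\,(a+b-k+\frac{1}{2})_{\lfloor\frac{c-b}{2}\rfloor}\,(a+c-k)_{-\lfloor\frac{c-b}{2}\rfloor}}$$ and $$\frac{M(H_{2a+1,b,c;d})}{M(H_{2a+1,b,c})}=\frac{1}{4^d}\prod_{k=0}^{d-1} \frac{(a+k+1)_{c-2k}\,(k+\frac{3}{2})_{c-2k-2}\,(b-k)_{\lfloor\frac{c-b}{2}\rfloor}\,(c-k-\frac{1}{2})_{-\lfloor\frac{c-b}{2}\rfloor}}{(k+1)_{c-2k-1}\,(a+k+\frac{3}{2})_{c-2k-1}\,(a+b-k+1)_{\lfloor\frac{c-b}{2}\rfloor}\,(a+c-k+\frac{1}{2})_{-\lfloor\frac{c-b}{2}\rfloor}}.$$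
   Context: Work on the triangular lattice of unit equilateral triangles in which one family of lattice lines is vertical. For nonnegative integers $p,b,c$, $H_{p,b,c}$ denotes the hexagon on this lattice whose side lengths, listed clockwise starting from the (vertical) left side, are $p,b,c,p,b,c$. For nonnegative integers $p,b,c,d$ such that the construction makes sense (in particular whenever $d\le\min(b,c)$), let $\ell$ be the perpendicular bisector (a horizontal line) of the left side of $H_{p,b,c}$, label the unit triangles of $H_{p,b,c}$ whose interiors meet $\ell$ by $1,2,3,\dots$ from left to right, and let $H_{p,b,c;d}$ be the region obtained from $H_{p,b,c}$ by deleting the unit triangles labeled $1,2,\dots,2d$ (so $H_{p,b,c;0}=H_{p,b,c}$). When $p$ is even the deleted triangles form $d$ consecutive lozenges along $\ell$; when $p$ is odd they form $d$ consecutive bowties. For a region $R$, $M(R)$ denotes the number of lozenge tilings of $R$ (a lozenge being the union of two unit triangles sharing an edge), with $M(R)=1$ if $R$ is empty. Shifted factorial: for $x$ a positive integer or positive half-integer and $n$ an integer with $x+n>0$, $(x)_n=x(x+1)\cdots(x+n-1)$ if $n>0$, $(x)_0=1$, and $(x)_n=\frac{1}{(x-1)(x-2)\cdots(x+n)}$ if $n<0$ (equivalently $(x)_n=\Gamma(x+n)/\Gamma(x)$). Empty products equal $1$. By MacMahon's theorem $M(H_{p,b,c})=\prod_{i=1}^{p}\prod_{j=1}^{b}\prod_{k=1}^{c}\frac{i+j+k-1}{i+j+k-2}$. *)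

(* Defs.v *)
From HB Require Import structures.
From mathcomp Require Import all_boot all_order all_algebra.
Set Implicit Arguments.
Unset Strict Implicit.
Unset Printing Implicit Defensive.
Import Order.TTheory GRing.Theory Num.Theory.

(* Triangular lattice with vertical lattice lines.                         *)
(* Lattice point (i, j) (i, j integers) sits at the Euclidean position     *)
(*   (i * sqrt 3 / 2,  j + i / 2).                                         *)
(* Lattice lines: i = const (vertical), j = const (up-right direction),    *)
(* i + j = const (down-right direction).  All unit triangles lie in a      *)
(* vertical strip i <= x <= i+1 and are                                    *)
(*   right-pointing  (true, i, j) : vertices (i,j), (i,j+1), (i+1,j)       *)
(*   left-pointing   (false, i, j): vertices (i+1,j), (i+1,j+1), (i,j+1)   *)
(* We only need nonnegative coordinates (see the placement of the hexagon  *)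
(* below), bounded by N.                                                   *)

Definition tri (N : nat) : finType := (bool * 'I_N * 'I_N)%type.

Definition tri_col N (t : tri N) : nat := nat_of_ord t.1.2.

Definition verts N (t : tri N) : seq (nat * nat) :=
  let: (r, i, j) := t in
  let i := nat_of_ord i in let j := nat_of_ord j in
  if r then [:: (i, j); (i, j.+1); (i.+1, j)]
  else [:: (i.+1, j); (i.+1, j.+1); (i, j.+1)].

Definition share_edge N (t1 t2 : tri N) : bool :=
  (t1 != t2) && (size [seq v <- verts t1 | v \in verts t2] == 2).

Definition is_lozenge N (L : {set tri N}) : bool :=
  [exists t1 : tri N, exists t2 : tri N, share_edge t1 t2 && (L == [set t1; t2])].

Definition lozenge_tiling N (R : {set tri N}) (T : {set {set tri N}}) : bool :=
  partition T R && [forall L in T, is_lozenge L].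

(* M(R): number of lozenge tilings (= 1 for the empty region). *)
Definition M N (R : {set tri N}) : nat :=
  #|[set T : {set {set tri N}} | lozenge_tiling R T]|.

(* The hexagon H_{p,b,c}: vertices (clockwise from the bottom of the left  *)
(* side) (0,c), (0,p+c), (b,p+c), (b+c,p), (b+c,0), (c,0); side lengths     *)
(* p (vertical, left), b, c, p, b, c.  It is the intersection of the half  *)
(* planes 0 <= i <= b+c, 0 <= j <= p+c, c <= i+j <= p+b+c; a unit triangle *)
(* belongs to it iff its three vertices do.                                *)

Definition hexN (p b c : nat) : nat := (p + b + c).+1.

Definition in_hex (p b c : nat) (v : nat * nat) : bool :=
  [&& v.1 <= b + c, v.2 <= p + c, c <= v.1 + v.2 & v.1 + v.2 <= p + b + c].

Definition Hex (p b c : nat) : {set tri (hexN p b c)} :=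
  [set t | all (in_hex p b c) (verts t)].

(* Doubled height (2y) of a lattice point. *)
Definition height2 (v : nat * nat) : nat := 2 * v.2 + v.1.

(* The perpendicular bisector l of the left side is the line y = c + p/2,  *)
(* i.e. 2y = 2c + p.  The interior of a unit triangle meets l iff          *)
(* min 2y < 2c+p < max 2y over its vertices.                               *)
Definition meets_l (p c : nat) N (t : tri N) : bool :=
  let hs := map height2 (verts t) in
  (foldr minn (head 0 hs) hs < 2 * c + p) && (2 * c + p < foldr maxn 0 hs).

(* Labels 1, 2, 3, ... from left to right of the triangles of H meeting l. *)
(* (Exactly one triangle of the lattice in each vertical strip meets l,    *)
(* so left-to-right order is the order of the column index.)               *)
Definition lab (p b c : nat) (t : tri (hexN p b c)) : nat :=
  #|[set t' in Hex p b c | meets_l p c t' && (tri_col t' < tri_col t)]|.+1.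

Definition HexD (p b c d : nat) : {set tri (hexN p b c)} :=
  Hex p b c :\: [set t in Hex p b c | meets_l p c t && (lab t <= 2 * d)].

(* Shifted factorial (x)_n for n an integer, (x)_n = Gamma(x+n)/Gamma(x).  *)
Local Open Scope ring_scope.

Definition poch (x : rat) (n : int) : rat :=
  match n with
  | Posz m => \prod_(i < m) (x + i%:R)
  | Negz m => (\prod_(i < m.+1) (x - (i.+1)%:R))^-1
  end.

(* Main.v *)
Require Import Defs.
From HB Require Import structures.
From mathcomp Require Import all_boot all_order all_algebra all_fingroup.
From mathcomp Require Import zify ring lra.
Set Implicit Arguments.
Unset Strict Implicit.
Unset Printing Implicit Defensive.
Import Order.TTheory GRing.Theory Num.Theory.
Local Open Scope ring_scope.

(** A tiling is a family of nonintersecting paths crossing the vertical lattice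
lines, so the number of tilings is a determinant whose columns are the starting
points and whose rows are the consecutive end points on the right side.  The
deleted lozenges or bowties form a wall on the axis: until the wall ends, [a]
paths stay above it and [a] stay below it, which the reflection principle turns
into odd functions evolving freely.  If [p] is odd, one more path starts at the
tip of the wall.

For fixed [a], let [A_d(b,c)] and [B_d(b,c)] be the counts for [p = 2a] and
[p = 2a+1].  Up to column operations the determinant of [A_d], and that of
[A_(d+1)], is obtained from the determinant of [B_d] by erasing the path that
starts at the tip.  A three-term Pluecker relation between a determinant and the
one with one path less then gives, for [X = A_d] and for [X = A_(d+1)],
[B_d(b,c) X(b,c) = B_d(b-1,c) X(b+1,c) + B_d(b,c-1) X(b,c+1)].
The first relation computes [B_d] from [A_d], the second computes [A_(d+1)] from
[B_d] and from the row [b = d+1], where the determinant splits into two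
determinants of odd functions.  These, and MacMahon's [A_0], are evaluated by the
same relation. *)

(** * A three-term relation for determinants *)

(** Past the end of the wall, upper and lower paths mix and their rows are no longer halves of odd
    functions, so nothing factors there. The relations get around this: walled determinants are
    computed directly only in windows where the two groups are still apart ([b = d + 1], or
    [b = c = d]). The relations can be solved because each product on the right is an explicit
    fraction of the left side. With [b] and [c] counted from the end of the wall, the fractions are
    [b / (b + c)] and [c / (b + c)] for [A_d], and [(a + b) / (2 a + b + c)] and
    [(a + c) / (2 a + b + c)] for [A_(d+1)]. On the tiling side no path is constructed. Strips are
    emptied from right to left: the choice between two lozenges is the splitting of a row [ev f]
    into two summands, and a collision of paths is a determinant with two equal rows. *)

(* [x] is the lattice coordinate [j - c]: a path keeps it on an up step and lowers
it by one on a down step. *)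
Definition ev (f : int -> rat) (x : int) : rat := f x + f (x + 1).

(* Rows are the [w] consecutive positions from [s] on, columns are the paths. *)
Definition wdet (w : nat) (F : nat -> int -> rat) (s : int) : rat :=
  \det (\matrix_(l < w, k < w) F k (s + l%:Z)).

Lemma det_row_replace n (A : 'M[rat]_n) (i0 : 'I_n) (v : 'rV[rat]_n) :
  \det (\matrix_(i, j) if i == i0 then v 0 j else A i j) = (v *m \adj A) 0 i0.
Proof.
rewrite (expand_det_row _ i0) mxE; apply: eq_bigr => k _.
rewrite !mxE eqxx; congr (_ * (_ * \det _)).
by apply/matrixP => i j; rewrite !mxE eq_sym (negbTE (neq_lift _ _)).
Qed.

(** The row operation is unitriangular. After it every row but the first is a row of [ev] one
    position lower, so a window of [F] is traded for one row of [F] and rows of [ev F]. *)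
Lemma wdet_rows_low n (F : nat -> int -> rat) (s : int) :
  \det (\matrix_(l < n, k < n)
     (F k (s + l%:Z) + (if l == 0%N :> nat then 0 else F k (s + l%:Z - 1))))
  = wdet n F s.
Proof.
pose U : 'M[rat]_n := \matrix_(l, k) ((l == k)%:R + (l == k.+1 :> nat)%:R).
rewrite -[RHS]mul1r.
have <- : \det U = 1.
  rewrite det_trig ?big1 // => [i _|].
    by rewrite mxE eqxx ltn_eqF ?ltnSn // addr0.
  apply/is_trig_mxP => i j ltij; rewrite mxE.
  rewrite -val_eqE !ltn_eqF ?addr0 // ltnS; exact: ltnW.
rewrite -det_mulmx; congr (\det _); apply/matrixP => l k; rewrite !mxE.
under eq_bigr do rewrite !mxE mulrDl.
rewrite big_split /= (bigD1 l) //= eqxx mul1r big1 ?addr0; last first.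
  by move=> i /negbTE; rewrite eq_sym => ->; rewrite mul0r.
congr (_ + _); case: eqP => [l0|/eqP l0].
  by rewrite big1 // => i _; rewrite l0 mul0r.
have lt : (l.-1 < n)%N by rewrite (leq_ltn_trans (leq_pred _)).
rewrite (bigD1 (Ordinal lt)) //= prednK ?lt0n // eqxx mul1r big1 ?addr0.
  by congr (F _ _); lia.
move=> i ne; case: eqP => [e|]; last by rewrite mul0r.
by case/eqP: ne; apply/val_inj => /=; rewrite e.
Qed.

Lemma wdet_rows_up n (F : nat -> int -> rat) (s : int) :
  \det (\matrix_(l < n.+1, k < n.+1)
     (F k (s + l%:Z) + (if l == n :> nat then 0 else F k (s + l%:Z + 1))))
  = wdet n.+1 F s.
Proof.
pose U : 'M[rat]_n.+1 := \matrix_(l, k) ((l == k)%:R + (l.+1 == k :> nat)%:R).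
rewrite -[RHS]mul1r.
have <- : \det U = 1.
  rewrite -det_tr det_trig ?big1 // => [i _|].
    by rewrite !mxE eqxx gtn_eqF ?ltnSn // addr0.
  apply/is_trig_mxP => i j ltij; rewrite !mxE.
  rewrite -val_eqE !gtn_eqF ?addr0 // ltnS; exact: ltnW.
rewrite -det_mulmx; congr (\det _); apply/matrixP => l k; rewrite !mxE.
under eq_bigr do rewrite !mxE mulrDl.
rewrite big_split /= (bigD1 l) //= eqxx mul1r big1 ?addr0; last first.
  by move=> i /negbTE; rewrite eq_sym => ->; rewrite mul0r.
congr (_ + _); case: eqP => [l0|/eqP l0].
  by rewrite big1 // => i _; rewrite l0 gtn_eqF ?mul0r.
have lt : (l.+1 < n.+1)%N by have := ltn_ord l; lia.
rewrite (bigD1 (Ordinal lt)) //= eqxx mul1r big1 ?addr0.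
  by congr (F _ _); lia.
move=> i ne; case: eqP => [e|]; last by rewrite mul0r.
by case/eqP: ne; apply/val_inj => /=; rewrite e.
Qed.

Lemma det_rotate_rows v (A : 'M[rat]_v.+1) :
  \det (\matrix_(i < v.+1, j < v.+1)
     (if insub i.+1 is Some i' then A i' j else A 0 j)) = (-1) ^+ v * \det A.
Proof.
pose p := lift_perm ord_max ord0 (1%g : 'S_v).
have -> : (-1) ^+ v = (-1) ^+ (p : bool) :> rat.
  by rewrite odd_lift_perm odd_perm1 /= addbF addbF signr_odd.
have <- : \det (perm_mx p) = (-1) ^+ (p : bool) :> rat by rewrite det_perm.
rewrite -det_mulmx -row_permE; congr (\det _); apply/matrixP => i j.
rewrite !mxE; case: (unliftP ord_max i) => [k ->|->].
  have lt : ((lift ord_max k).+1 < v.+1)%N.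
    by have := ltn_ord k; rewrite /= /bump; lia.
  rewrite lift_perm_lift perm1.
  rewrite (insubT (fun i => i < v.+1)%N lt) /=.
  congr (A _ _); apply/val_inj => /=; rewrite /bump /=.
  by have := ltn_ord k; rewrite [v.+1.-1]/=; case: leqP => /=; lia.
by rewrite lift_perm_id insubF //= ltnn.
Qed.

(* Expand [z_1 = F _ (s+1)] on the rows [y_i = z_i + z_(i+1)] by Cramer's rule, and
apply the linear form [y |-> det (y, y_1, .., y_(v))] of one dimension less. *)
Lemma wdet_flag w (F : nat -> int -> rat) (s : int) :
  wdet w.+1 (fun k => ev (F k)) s * wdet w F (s + 1)
  = wdet w.+1 F s * wdet w (fun k => ev (F k)) (s + 1)
    + wdet w.+1 F (s + 1) * wdet w (fun k => ev (F k)) s.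
Proof.
case: w => [|v].
  by rewrite /wdet !det_mx00 !det_mx11 !mxE /= !mulr1 /ev addr0 addr0.
pose z (x : int) : 'rV[rat]_v.+2 := \row_k F k x.
pose X : 'M[rat]_v.+2 := \matrix_(l, k) ev (F k) (s + l%:Z).
pose Y : 'M[rat]_v.+1 := \matrix_(l, k) ev (F k) (s + l%:Z).
pose q (c : 'rV[rat]_v.+2) i := (c *m \adj X) 0 i.
pose res (c : 'rV[rat]_v.+2) : 'rV[rat]_v.+1 :=
  \row_k c 0 (widen_ord (leqnSn _) k).
pose psi (c : 'rV[rat]_v.+2) := (res c *m \adj Y) 0 0.
have rowX (l : 'I_v.+2) : row l X = z (s + l%:Z) + z (s + l%:Z + 1).
  by apply/rowP => k; rewrite !mxE.
have resD c1 c2 : res (c1 + c2) = res c1 + res c2.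
  by apply/rowP => k; rewrite !mxE.
have resZ a c : res (a *: c) = a *: res c.
  by apply/rowP => k; rewrite !mxE.
have psiD c1 c2 : psi (c1 + c2) = psi c1 + psi c2.
  by rewrite /psi resD mulmxDl mxE.
have psiZ a c : psi (a *: c) = a * psi c.
  by rewrite /psi resZ -scalemxAl mxE.
have psi0 : psi 0 = 0 by rewrite -(scale0r (z 0)) psiZ mul0r.
have cram c : \det X * psi c = \sum_i q c i * psi (row i X).
  rewrite -psiZ -mul_mx_scalar -mul_adj_mx mulmxA mulmx_sum_row.
  by rewrite (big_morph psi psiD psi0); apply: eq_bigr => i _; rewrite psiZ.
have resrow (l : 'I_v.+1) : res (row (widen_ord (leqnSn _) l) X) = row l Y.
  by apply/rowP => k; rewrite !mxE.
have psirow (l : 'I_v.+1) :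
    psi (row (widen_ord (leqnSn _) l) X) = \det Y *+ (l == 0).
  by rewrite /psi resrow -row_mul mul_mx_adj !mxE.
have qrow (l i : 'I_v.+2) : q (row l X) i = \det X *+ (l == i).
  by rewrite /q -row_mul mul_mx_adj !mxE.
have qD c1 c2 i : q (c1 + c2) i = q c1 i + q c2 i by rewrite /q mulmxDl mxE.
have q0 : q (z (s + 1)) 0 = wdet v.+2 F (s + 1).
  rewrite /q -det_row_replace -wdet_rows_low; congr (\det _).
  apply/matrixP => l k; rewrite !mxE -val_eqE /=.
  case: eqP => [->|_]; first by rewrite !addr0.
  by rewrite /ev addrC; congr (F k _ + F k _); lia.
have qmax : q (z (s + 1)) ord_max = (-1) ^+ v * wdet v.+2 F s.
  (* For [i <= v], row [i] of [X] is the sum of two consecutive vectors [z] and has last Cramer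
     coefficient 0. Hence the coefficient only changes sign along the window, until [z] reaches the
     position that [wdet_rows_up] requires. *)
  have step (i : nat) : (i <= v)%N ->
      q (z (s + i%:Z + 1)) ord_max = - q (z (s + i%:Z)) ord_max.
    move=> le; have lt : (i < v.+2)%N by lia.
    have := qrow (Ordinal lt) ord_max.
    rewrite -val_eqE /= ltn_eqF ?ltnS // rowX qD /= mulr0n => /eqP.
    by rewrite addrC addr_eq0 => /eqP.
  have all_steps (i : nat) : (i <= v)%N ->
      q (z (s + 1)) ord_max = (-1) ^+ i * q (z (s + i.+1%:Z)) ord_max.
    elim: i => [|i IH] le; first by rewrite mul1r.
    rewrite IH ?(ltnW le) //.
    have -> : s + i.+2%:Z = s + i.+1%:Z + 1 by lia.
    by rewrite step // exprS mulN1r mulrNN.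
  rewrite (all_steps v) //; congr (_ * _).
  rewrite /q -det_row_replace -wdet_rows_up; congr (\det _).
  apply/matrixP => l k; rewrite !mxE -val_eqE /=.
  by case: eqP => [->|_]; rewrite ?addr0.
have psiz : psi (z (s + 1)) = wdet v.+1 F (s + 1).
  rewrite /psi -det_row_replace -wdet_rows_low; congr (\det _).
  apply/matrixP => l k; rewrite !mxE -val_eqE /=.
  case: eqP => [->|_]; first by rewrite !addr0.
  by rewrite /ev addrC; congr (F k _ + F k _); lia.
have psimax : psi (row ord_max X)
    = (-1) ^+ v * wdet v.+1 (fun k => ev (F k)) (s + 1).
  apply: (mulrI (unitrX v (unitrN1 _))).
  rewrite mulrA -exprD addnn -mul2n exprM sqrrN !expr1n mul1r.
  rewrite /psi -det_row_replace -det_rotate_rows; congr (\det _).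
  apply/matrixP => l k; rewrite !mxE.
  case: insubP => [i _ def_i|ge].
    rewrite !mxE -val_eqE /= def_i /=; congr (ev _ _).
    by lia.
  rewrite ?mxE /=; congr (ev _ _).
  have -> : nat_of_ord l = v by have := ltn_ord l; lia.
  by lia.
have := cram (z (s + 1)); rewrite psiz -/(wdet _ _ _) => ->.
(* [psi] vanishes on the middle rows of [X], which repeat a row of [Y]; only the first and the last
   term remain. *)
rewrite big_ord_recr /= (bigD1 0) //= big1 => [|i ne].
  rewrite psirow eqxx mulr1n psimax qmax addr0.
  have -> : widen_ord (leqnSn v.+1) 0 = 0 by apply/val_inj.
  rewrite q0 [LHS]addrC; congr (_ + _).
  rewrite mulrACA -exprD addnn -mul2n exprM sqrrN !expr1n mul1r; ring.
by rewrite psirow (negbTE ne) mulr0n mulr0.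
Qed.

(** * Closed forms *)

Definition fac (n : nat) : rat := n`!%:R.

Lemma facS n : fac n.+1 = n.+1%:R * fac n.
Proof. by rewrite /fac factS natrM. Qed.

Lemma fac_neq0 n : fac n != 0.
Proof. by rewrite /fac pnatr_eq0 -lt0n fact_gt0. Qed.

Lemma fac0 : fac 0 = 1.
Proof. by []. Qed.

(* MacMahon's box formula. *)
Definition mac (p b c : nat) : rat :=
  \prod_(i < p) (fac i * fac (b + c + i) / (fac (b + i) * fac (c + i))).

(* [symp a x c] counts the families of [a] paths that start at the heights
1/2, .., a - 1/2, stay positive and make [c + x] up and [c] down steps each. *)
Definition sfac (j x c : nat) : rat :=
  fac (c + c + x + j + j) * fac j * fac (x + j + j).+1 * fac (c + x + j)
  / (fac (c + j) * fac (c + x + j + j).+1 * fac (c + x + j + j) * fac (x + j)).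

Definition symp (a x c : nat) : rat := \prod_(j < a) sfac j x c.

(* The closed forms of [A_d(d + b, d + c)] ([evenval]) and [B_d(d + b, d + c)]
([oddval]), as products over [j < a] so that every identity between them
reduces to one factor. *)
Definition afac (j d b c : nat) : rat :=
  fac (j + j).+1 * fac (d + d + b + c + j + j) * fac (d + d + j + j)
  * fac j ^+ 2 * fac (d + b + j) * fac (d + c + j) * fac (b + c + j + j).+1
  / (fac (d + b + j + j) * fac (d + c + j + j) * fac (d + b + j + j).+1
     * fac (d + c + j + j).+1 * fac (d + j) ^+ 2 * fac (b + j) * fac (c + j)).

Definition evenval (a d b c : nat) : rat := \prod_(j < a) afac j d b c.

Definition bfac (j d b c : nat) : rat :=
  fac (j + j).+1 * fac (d + d + b + c + j + j).+1 * fac (d + d + j + j).+2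
  * fac j.+1 * fac j * fac (d + b + j).+1 * fac (d + c + j).+1
  * fac (b + c + j + j).+2
  / (fac (d + b + j + j).+1 * fac (d + c + j + j).+1 * fac (d + b + j + j).+2
     * fac (d + c + j + j).+2 * fac (d + j).+1 * fac (d + j)
     * fac (b + j).+1 * fac (c + j).+1).

(** The binomial coefficient counts the path from the tip alone, which is the case [a = 0]. *)
Definition oddval (a d b c : nat) : rat :=
  fac (b + c) / (fac b * fac c) * \prod_(j < a) bfac j d b c.

Ltac facnorm := rewrite ?(addSn, addnS, addn0, add0n, facS, fac0).
Ltac neqs :=
  repeat (apply/andP; split); rewrite ?fac_neq0 //;
  apply: lt0r_neq0;
  repeat match goal with
  | |- context [?n%:R] =>
      first [is_var n | lazymatch n with nat_of_ord _ => idtac end];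
      let H := fresh in
      have H : 0 <= (n%:R : rat) by [apply: ler0n];
      move: H; move: (n%:R : rat) => ?
  end; intros; lra.
Ltac facfield := facnorm; field; neqs.
(** Factorials and successors become independent unknowns. This suffices when both sides are
    monomials in them; [facfield] serves the identities that depend on the values of the
    successors. *)
Ltac atomize :=
  repeat match goal with
  | |- context [fac ?n] =>
      move: (fac_neq0 n); move: (fac n) => ? ?
  | |- context [?n.+1%:R] =>
      have: (n.+1%:R != 0 :> rat) by [rewrite pnatr_eq0];
      move: (n.+1%:R : rat) => ? ?
  end.
Ltac facmono :=
  facnorm; atomize; field; repeat (apply/andP; split); assumption.

Lemma mac_recS p b c :
  mac p b.+1 c = mac p b c * (fac (b + c + p) * fac b / (fac (b + c) * fac (b + p))).
Proof.
elim: p => [|p IH].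
  rewrite /mac !big_ord0 mul1r !addn0; field; neqs.
rewrite /mac !big_ord_recr /= -!/(mac _ _ _) IH.
by facfield.
Qed.

Lemma mac_sym p b c : mac p b c = mac p c b.
Proof.
by apply: eq_bigr => i _; rewrite [(b + c)%N]addnC [fac (b + i) * _]mulrC.
Qed.

Lemma mac_recSr p b c :
  mac p b c.+1 = mac p b c * (fac (b + c + p) * fac c / (fac (b + c) * fac (c + p))).
Proof. by rewrite mac_sym mac_recS mac_sym [(c + b)%N]addnC. Qed.

Lemma mac0l p c : mac p 0 c = 1.
Proof.
by rewrite /mac big1 // => i _; rewrite !add0n divff // mulf_neq0 // fac_neq0.
Qed.

Lemma mac0r p b : mac p b 0 = 1.
Proof. by rewrite mac_sym mac0l. Qed.

Lemma mac_neq0 p b c : mac p b c != 0.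
Proof.
by apply/prodf_neq0 => i _; rewrite mulf_neq0 ?invr_eq0 ?mulf_neq0 ?fac_neq0.
Qed.

Lemma mac_rec p b c :
  mac p.+1 b.+1 c.+1 * mac p b.+1 c
  = mac p.+1 b c.+1 * mac p b.+2 c + mac p.+1 b.+1 c * mac p b.+1 c.+1.
Proof.
have mS q x y : mac q.+1 x y
    = mac q x y * (fac q * fac (x + y + q) / (fac (x + q) * fac (y + q))).
  by rewrite /mac big_ord_recr.
rewrite !mS !mac_recS !mac_recSr.
by facfield.
Qed.

Lemma sfac_neq0 j x c : sfac j x c != 0.
Proof. by rewrite /sfac !(mulf_neq0, invr_eq0, fac_neq0). Qed.

Lemma symp_neq0 a x c : symp a x c != 0.
Proof. by apply/prodf_neq0 => j _; apply: sfac_neq0. Qed.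

Lemma sympS a x c : symp a.+1 x c = symp a x c * sfac a x c.
Proof. by rewrite /symp big_ord_recr. Qed.

Lemma symp0 a x : symp a x 0 = 1.
Proof. by rewrite /symp big1 // => j _; rewrite /sfac !add0n; facfield. Qed.

Lemma symp_rec0 a c :
  symp a.+1 0 c.+1 * symp a 1 c = symp a.+1 1 c * symp a 0 c.+1.
Proof. by rewrite !sympS /sfac; facfield. Qed.

(** The first product on the right of [symp_rec] as a fraction of the left side. The factors
    telescope in [a] instead of cancelling one by one, whence the induction. *)
Lemma symp_shift a x c :
  symp a.+1 x c.+1 * symp a x.+3 c
    * (c + c + x + a + a).+3%:R * (x + a).+2%:R
  = symp a.+1 x.+1 c.+1 * symp a x.+2 c
    * (c + x + a + a).+3%:R * x.+1%:R.
Proof.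
elim: a => [|a IH].
  by rewrite /symp !big_ord1 !big_ord0 /sfac; facmono.
rewrite [symp a.+2 x c.+1]sympS [symp a.+1 x.+3 c]sympS.
rewrite [symp a.+2 x.+1 c.+1]sympS [symp a.+1 x.+2 c]sympS.
have n1 : (c + c + x + a + a).+3%:R * (x + a).+2%:R != 0 :> rat.
  by rewrite mulf_neq0 ?pnatr_eq0.
apply: (mulIf n1).
transitivity (symp a.+1 x c.+1 * symp a x.+3 c
    * (c + c + x + a + a).+3%:R * (x + a).+2%:R
    * (sfac a.+1 x c.+1 * sfac a x.+3 c * (c + c + x + a.+1 + a.+1).+3%:R
       * (x + a.+1).+2%:R)); first by ring.
rewrite IH /sfac; move: (symp _ _ _) (symp _ _ _) => u v.
by facmono.
Qed.

Lemma symp_rec a x c :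
  symp a.+1 x.+1 c.+1 * symp a x.+2 c
  = symp a.+1 x c.+1 * symp a x.+3 c + symp a.+1 x.+2 c * symp a x.+1 c.+1.
Proof.
have n1 : (c + c + x + a + a).+3%:R != 0 :> rat by rewrite pnatr_eq0.
have n2 : (x + a).+2%:R != 0 :> rat by rewrite pnatr_eq0.
apply: (mulIf n1); apply: (mulIf n2); rewrite 2!mulrDl symp_shift.
have -> : symp a.+1 x.+2 c * symp a x.+1 c.+1 * (c + c + x + a + a).+3%:R
    * (x + a).+2%:R
  = symp a.+1 x.+1 c.+1 * symp a x.+2 c * ((c + a).+1%:R * (x + a + a).+3%:R).
  rewrite [symp a.+1 x.+1 _]sympS [symp a.+1 x.+2 _]sympS /sfac.
  by move: (symp _ _ _) (symp _ _ _) => u v; facmono.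
(* There remains [(2c+x+2a+3)(x+a+2) = (c+x+2a+3)(x+1) + (c+a+1)(x+2a+3)]. *)
by ring.
Qed.

Lemma evenvalS a d b c : evenval a.+1 d b c = evenval a d b c * afac a d b c.
Proof. by rewrite /evenval big_ord_recr. Qed.

Lemma oddvalS a d b c : oddval a.+1 d b c = oddval a d b c * bfac a d b c.
Proof. by rewrite /oddval big_ord_recr mulrA. Qed.

Lemma evenval_neq0 a d b c : evenval a d b c != 0.
Proof.
by apply/prodf_neq0 => j _; rewrite !(mulf_neq0, expf_neq0, invr_eq0, fac_neq0).
Qed.

Lemma oddval_neq0 a d b c : oddval a d b c != 0.
Proof.
rewrite mulf_neq0 // ?mulf_neq0 ?invr_eq0 ?mulf_neq0 ?fac_neq0 //.
by apply/prodf_neq0 => j _; rewrite !(mulf_neq0, invr_eq0, fac_neq0).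
Qed.

Lemma evenval_sym a d b c : evenval a d b c = evenval a d c b.
Proof.
apply: eq_bigr => j _; rewrite /afac [(b + c)%N]addnC [(d + d + b + c)%N]addnAC.
by field; neqs.
Qed.

Lemma oddval_sym a d b c : oddval a d b c = oddval a d c b.
Proof.
rewrite /oddval [(b + c)%N]addnC [fac b * _]mulrC; congr (_ * _).
apply: eq_bigr => j _; rewrite /bfac [(b + c)%N]addnC [(d + d + b + c)%N]addnAC.
by field; neqs.
Qed.

Lemma evenval_mac a b c : evenval a 0 b c = mac (a + a) b c.
Proof.
elim: a => [|a IH]; first by rewrite /evenval /mac !big_ord0.
rewrite evenvalS IH addnS addSn /mac 2!big_ord_recr /= -/(mac _ _ _) /afac.
rewrite !(add0n, addnS) !addnA; move: (mac _ _ _) => u.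
by facmono.
Qed.

Lemma evenval_base a d c : evenval a d 0 c = symp a 0 d * symp a c d.
Proof.
rewrite /evenval /symp -big_split; apply: eq_bigr => j _.
by rewrite /afac /sfac /= !(addn0, add0n); facmono.
Qed.

Lemma oddval_base a d : oddval a d 0 0 = symp a 1 d ^+ 2.
Proof.
rewrite /oddval !fac0 divr1 mul1r expr2 /symp -big_split; apply: eq_bigr => j _.
by rewrite /bfac /sfac /= !(addn0, add0n); facfield.
Qed.

(** One product on the right of the relation for [A_d], as a fraction of the left side. The other is
    [odd_even_shiftr]; at matching indices the two fractions add up to 1. *)
Lemma odd_even_shift a d b c :
  oddval a d b c * evenval a d b.+2 c * (b + c).+1%:R
  = oddval a d b.+1 c * evenval a d b.+1 c * b.+1%:R.
Proof.
elim: a => [|a IH].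
  by rewrite /oddval /evenval !big_ord0; facmono.
rewrite !oddvalS !evenvalS.
transitivity (oddval a d b c * evenval a d b.+2 c * (b + c).+1%:R
              * (bfac a d b c * afac a d b.+2 c)); first by ring.
rewrite IH.
transitivity (oddval a d b.+1 c * evenval a d b.+1 c * b.+1%:R
              * (bfac a d b.+1 c * afac a d b.+1 c)); last by ring.
by congr (_ * _); rewrite /bfac /afac; facmono.
Qed.

(** The analogue for the relation with [A_(d+1)]. Here the fraction depends on [a], so the factors
    telescope. *)
Lemma odd_even_next a d b c :
  oddval a d b c.+1 * evenval a d.+1 b.+1 c * (b + c + a + a).+2%:R
  = oddval a d b.+1 c.+1 * evenval a d.+1 b c * (b + a).+1%:R.
Proof.
elim: a => [|a IH].
  by rewrite /oddval /evenval !big_ord0; facmono.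
have n1 : (b + c + a + a).+2%:R != 0 :> rat by rewrite pnatr_eq0.
rewrite !oddvalS !evenvalS; apply: (mulIf n1).
transitivity (oddval a d b c.+1 * evenval a d.+1 b.+1 c * (b + c + a + a).+2%:R
  * (bfac a d b c.+1 * afac a d.+1 b.+1 c * (b + c + a.+1 + a.+1).+2%:R)).
  by ring.
rewrite IH.
transitivity (oddval a d b.+1 c.+1 * evenval a d.+1 b c
  * ((b + a).+1%:R * (bfac a d b c.+1 * afac a d.+1 b.+1 c
     * (b + c + a.+1 + a.+1).+2%:R))); first by ring.
transitivity (oddval a d b.+1 c.+1 * evenval a d.+1 b c
  * (bfac a d b.+1 c.+1 * afac a d.+1 b c * (b + a.+1).+1%:R
     * (b + c + a + a).+2%:R)); last by ring.
by congr (_ * _); rewrite /bfac /afac; facmono.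
Qed.

(** * Evaluation of the path determinants *)

Definition dlt (k x : int) : rat := (x == k)%:R.

Lemma eq_wdet w F G s t :
  (forall k l, (k < w)%N -> (l < w)%N -> F k (s + l%:Z) = G k (t + l%:Z)) ->
  wdet w F s = wdet w G t.
Proof.
by move=> eqFG; congr (\det _); apply/matrixP => l k; rewrite !mxE eqFG.
Qed.

Lemma wdet0 F s : wdet 0 F s = 1.
Proof. exact: det_mx00. Qed.

Lemma iter_ev_right n f k : (forall x, k < x -> f x = 0) ->
  (forall x, k < x -> iter n ev f x = 0) /\ iter n ev f k = f k.
Proof.
move=> f0; elim: n => [|n [IH1 IH2]] //=; split => [x kx|].
  by rewrite /ev !IH1 ?addr0 //; lia.
by rewrite /ev IH2 IH1 ?addr0 //; lia.
Qed.

Lemma iter_ev_left n f k : (forall x, x < k -> f x = 0) ->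
  (forall x, x < k - n%:Z -> iter n ev f x = 0) /\ iter n ev f (k - n%:Z) = f k.
Proof.
move=> f0; elim: n => [|n [IH1 IH2]] /=.
  by rewrite subr0; split=> // x lt; apply: f0.
split => [x kx|]; first by rewrite /ev !IH1 ?addr0 //; lia.
have -> : k - n.+1%:Z = k - n%:Z - 1 by lia.
by rewrite /ev IH1 ?add0r ?subrK //; lia.
Qed.

Lemma iter_ev_local n f g x :
  (forall y, x <= y -> y <= x + n%:Z -> f y = g y) ->
  iter n ev f x = iter n ev g x.
Proof.
elim: n x => [|n IH] x eqfg /=; first by apply: eqfg; lia.
by congr (_ + _); apply: IH => y *; apply: eqfg; lia.
Qed.

Lemma iter_ev_shift n f t x :
  iter n ev (fun y => f (y - t)) x = iter n ev f (x - t).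
Proof.
by elim: n x => [|n IH] x //=; rewrite /ev !IH addrAC.
Qed.

Lemma iter_ev_lin n f g (t : rat) x :
  iter n ev (fun y => f y + t * g y) x = iter n ev f x + t * iter n ev g x.
Proof. elim: n x => [|n IH] x //=; rewrite /ev !IH; ring. Qed.

Lemma iter_ev_opp n f x : iter n ev (fun y => - f y) x = - iter n ev f x.
Proof. elim: n x => [|n IH] x //=; rewrite /ev !IH; ring. Qed.

Lemma wdet_unitriU w F s :
  (forall k l, (k < l < w)%N -> F k (s + l%:Z) = 0) ->
  (forall k, (k < w)%N -> F k (s + k%:Z) = 1) -> wdet w F s = 1.
Proof.
move=> F0 F1; rewrite /wdet -det_tr det_trig.
  by rewrite big1 // => i _; rewrite !mxE F1.
by apply/is_trig_mxP => i j lt; rewrite !mxE F0 // lt /=.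
Qed.

Lemma wdet_unitriL w F s :
  (forall k l, (l < k < w)%N -> F k (s + l%:Z) = 0) ->
  (forall k, (k < w)%N -> F k (s + k%:Z) = 1) -> wdet w F s = 1.
Proof.
move=> F0 F1; rewrite /wdet det_trig.
  by rewrite big1 // => i _; rewrite !mxE F1.
by apply/is_trig_mxP => i j lt; rewrite !mxE F0 // lt /=.
Qed.

Definition pdet (w : nat) (F : nat -> int -> rat) (n : nat) (s : int) : rat :=
  wdet w (fun k => iter n ev (F k)) s.

Lemma pdet_flag w F n s :
  pdet w.+1 F n.+1 s * pdet w F n (s + 1)
  = pdet w.+1 F n s * pdet w F n.+1 (s + 1)
    + pdet w.+1 F n (s + 1) * pdet w F n.+1 s.
Proof. exact: wdet_flag. Qed.

(** For [b = 0] or [c = 0] all paths are forced and the matrix is unitriangular; otherwise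
    [pdet_flag] reduces to fewer paths or a smaller [b] or [c]. *)
Lemma pdet_mac p b c : pdet p (fun k => dlt k) (b + c) (- c%:Z) = mac p b c.
Proof.
elim: p b c => [|p IHp]; first by move=> b c; rewrite /pdet wdet0 /mac big_ord0.
elim=> [|b IHb].
  move=> c; rewrite mac0l add0n; apply: wdet_unitriL => [k l /andP[lk _]|k _].
    have [|H _] := @iter_ev_left c (dlt k) k; last by apply: H; lia.
    by move=> x lt; rewrite /dlt lt_eqF.
  have [|_ H] := @iter_ev_left c (dlt k) k.
    by move=> x lt; rewrite /dlt lt_eqF.
  by rewrite addrC H /dlt eqxx.
elim=> [|c IHc].
  rewrite mac0r addn0 oppr0; apply: wdet_unitriU => [k l /andP[lk _]|k _].
    have [|H _] := @iter_ev_right b.+1 (dlt k) k; last by apply: H; lia.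
    by move=> x lt; rewrite /dlt gt_eqF.
  have [|_ H] := @iter_ev_right b.+1 (dlt k) k.
    by move=> x lt; rewrite /dlt gt_eqF.
  by rewrite add0r H /dlt eqxx.
have := pdet_flag p (fun k => dlt k) (b + c).+1 (- c.+1%:Z).
have -> : - c.+1%:Z + 1 = - c%:Z by lia.
have -> : pdet p (fun k => dlt k) (b + c).+1 (- c%:Z) = mac p b.+1 c.
  exact: (IHp b.+1).
have -> : pdet p (fun k => dlt k) (b + c).+2 (- c%:Z) = mac p b.+2 c.
  exact: (IHp b.+2).
have -> : pdet p.+1 (fun k => dlt k) (b + c).+1 (- c%:Z) = mac p.+1 b.+1 c.
  exact: IHc.
have -> : pdet p (fun k => dlt k) (b + c).+2 (- c.+1%:Z) = mac p b.+1 c.+1.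
  by rewrite -IHp addnS.
have -> : pdet p.+1 (fun k => dlt k) (b + c).+1 (- c.+1%:Z) = mac p.+1 b c.+1.
  by rewrite -IHb addnS.
by rewrite -mac_rec addSn addnS => /(mulIf (mac_neq0 _ _ _)).
Qed.

(* At time [n] the axis is the fixed point of [x |-> -1 - n - x]. *)
Definition odd_dlt (k : nat) (x : int) : rat := dlt k x - dlt (-1 - k%:Z) x.

Lemma iter_ev_odd n k x :
  iter n ev (odd_dlt k) x = - iter n ev (odd_dlt k) (-1 - n%:Z - x).
Proof.
elim: n x => [|n IH] x /=.
  rewrite /odd_dlt /dlt opprB subr0; congr (_%:R - _%:R); apply/eqP/eqP; lia.
rewrite /ev IH (IH (x + 1)).
have -> : -1 - n.+1%:Z - x + 1 = -1 - n%:Z - x by lia.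
have -> : -1 - n.+1%:Z - x = -1 - n%:Z - (x + 1) by lia.
by ring.
Qed.

Lemma pdet_symp a x c :
  pdet a odd_dlt (c + c + x) (- c%:Z) = symp a x c.
Proof.
elim: a x c => [|a IHa] x c; first by rewrite /pdet wdet0 /symp big_ord0.
elim: c x => [|c IHc] x.
  rewrite symp0 oppr0; apply: wdet_unitriU => [k l /andP[kl _]|k _].
    have [|H _] := @iter_ev_right (0 + 0 + x) (odd_dlt k) k.
      by move=> y lt; rewrite /odd_dlt /dlt !gt_eqF //; lia.
    by rewrite H //; lia.
  have [|_ H] := @iter_ev_right (0 + 0 + x) (odd_dlt k) k.
    by move=> y lt; rewrite /odd_dlt /dlt !gt_eqF //; lia.
  by rewrite add0r H /odd_dlt /dlt eqxx gt_eqF ?subr0 //; lia.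
elim: x => [|x IHx].
  have := pdet_flag a odd_dlt (c + c).+1 (- c.+1%:Z).
  have -> : - c.+1%:Z + 1 = - c%:Z by lia.
  have -> : pdet a odd_dlt (c + c).+1 (- c%:Z) = symp a 1 c.
    by rewrite -IHa addn1.
  have -> : pdet a.+1 odd_dlt (c + c).+1 (- c%:Z) = symp a.+1 1 c.
    by rewrite -IHc addn1.
  have -> : pdet a odd_dlt (c + c).+2 (- c.+1%:Z) = symp a 0 c.+1.
    by rewrite -IHa addn0 addnS.
  (* Row 0 lies on the axis: [- c - 1] is the fixed point of the reflection after [2c + 1] steps,
     and odd functions vanish there. The relation thus loses a term. *)
  have -> : pdet a.+1 odd_dlt (c + c).+1 (- c.+1%:Z) = 0.
    rewrite /pdet /wdet (expand_det_row _ 0) big1 // => k _.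
    rewrite mxE addr0; set y := iter _ _ _ _.
    have : y = - y.
      rewrite {1}/y iter_ev_odd; congr (- iter _ _ _ _); lia.
    by move=> e; have y0 : y = 0 by [lra]; rewrite y0 mul0r.
  rewrite mul0r add0r -symp_rec0 addSn addnS addn0.
  by move/(mulIf (symp_neq0 _ _ _)).
have := pdet_flag a odd_dlt (c + c + x).+2 (- c.+1%:Z).
have -> : - c.+1%:Z + 1 = - c%:Z by lia.
have -> : pdet a odd_dlt (c + c + x).+2 (- c%:Z) = symp a x.+2 c.
  by rewrite -IHa !addnS.
have -> : pdet a.+1 odd_dlt (c + c + x).+2 (- c%:Z) = symp a.+1 x.+2 c.
  by rewrite -IHc !addnS.
have -> : pdet a odd_dlt (c + c + x).+3 (- c%:Z) = symp a x.+3 c.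
  by rewrite -IHa !addnS.
have -> : pdet a odd_dlt (c + c + x).+3 (- c.+1%:Z) = symp a x.+1 c.+1.
  by rewrite -IHa !addnS !addSn.
have -> : pdet a.+1 odd_dlt (c + c + x).+2 (- c.+1%:Z) = symp a.+1 x c.+1.
  by rewrite -IHx addnS !addSn.
rewrite -symp_rec !addnS !addSn.
by move/(mulIf (symp_neq0 _ _ _)).
Qed.

(** * Rows of paths running along a wall *)

Definition cut (x0 : int) (f : int -> rat) (x : int) : rat :=
  if x == x0 then 0 else f x.

(* The paths of [p = 2a] after [2 d] ([vrow]) and [2 d + 1] ([hrow]) lines with
walls of length [d] and [d + 1]; [brow] adds the path starting at the tip. *)
Fixpoint vrow (a d k : nat) : int -> rat :=
  if d is e.+1 then ev (cut (a%:Z - e%:Z - 1) (ev (vrow a e k))) else dlt k.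

Definition hrow (a d k : nat) : int -> rat :=
  cut (a%:Z - d%:Z - 1) (ev (vrow a d k)).

Definition brow (a d k : nat) : int -> rat :=
  if (k < a + a)%N then hrow a d k else dlt (a%:Z - d%:Z - 1).

(** From the half line above [s], a step can leave only to [s - 1]; cutting that cell leaves the
    free evolution of [g] on the same half line. *)
Lemma cut_ev_top f g s : (forall y, f y = if s <= y then g y else 0) ->
  forall x, cut (s - 1) (ev f) x = if s <= x then ev g x else 0.
Proof.
move=> fE x; rewrite /cut /ev !fE; case: eqP => [->|ne].
  by rewrite ifF //; lia.
case: (leP s x) => le; first by rewrite ifT //; lia.
by rewrite ifF ?addr0 //; lia.
Qed.

(** Without a cut the half line gains the cell [s - 1]. The truncated sum is still the free one
    there, because the missing summand is [g (s - 1)]. *)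
Lemma ev_top f g s : (forall y, f y = if s <= y then g y else 0) ->
  g (s - 1) = 0 -> forall x, ev f x = if s - 1 <= x then ev g x else 0.
Proof.
move=> fE g0 x; rewrite /ev !fE; case: (ltgtP x (s - 1)) => [lt|lt|->].
- by rewrite !ifF ?addr0 //; lia.
- by rewrite !ifT //; lia.
by rewrite g0 ifF ?ifT //; lia.
Qed.

Lemma cut_ev_bot f g s : (forall y, f y = if y < s then g y else 0) ->
  forall x, cut (s - 1) (ev f) x = if x < s - 1 then ev g x else 0.
Proof.
move=> fE x; rewrite /cut /ev !fE; case: eqP => [->|ne]; first by rewrite ltxx.
case: (ltP x (s - 1)) => le; first by rewrite !ifT //; lia.
by rewrite !ifF ?addr0 //; lia.
Qed.

Lemma ev_bot f g s : (forall y, f y = if y < s then g y else 0) ->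
  g s = 0 -> forall x, ev f x = if x < s then ev g x else 0.
Proof.
move=> fE g0 x; rewrite /ev !fE; case: (ltP x s) => lt; last first.
  by rewrite ifF ?addr0 //; lia.
case: ifP => // /negbT; rewrite -leNgt => le.
by have -> : x + 1 = s by [lia]; rewrite g0.
Qed.

Lemma iter_ev_odd0 d j : iter (d + d).+1 ev (odd_dlt j) (- d%:Z - 1) = 0.
Proof.
set z := iter _ _ _ _; have e : z = - z.
  by rewrite {1}/z iter_ev_odd; congr (- iter _ _ _ _); lia.
by lra.
Qed.

Lemma ev_shift n j (t : int) x :
  ev (fun y => iter n ev (odd_dlt j) (y - t)) x
  = iter n.+1 ev (odd_dlt j) (x - t).
Proof. by rewrite /= /ev addrAC. Qed.

(** On odd lines the cut cell lies on the axis, where the odd function is zero anyway; the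
    truncation therefore never disturbs the free evolution. *)
Lemma vrow_top a d j x : vrow a d (a + j) x
  = if a%:Z - d%:Z <= x then iter (d + d) ev (odd_dlt j) (x - a%:Z) else 0.
Proof.
elim: d x => [|d IH] x.
  rewrite /= subr0 /odd_dlt /dlt; case: leP => le; last by rewrite lt_eqF //; lia.
  have -> : (x - a%:Z == -1 - j%:Z) = false by lia.
  by rewrite subr0; congr (_%:R); lia.
have H y : cut (a%:Z - d%:Z - 1) (ev (vrow a d (a + j))) y
    = if a%:Z - d%:Z <= y
      then iter (d + d).+1 ev (odd_dlt j) (y - a%:Z) else 0.
  by rewrite (cut_ev_top IH) ev_shift.
rewrite -[LHS]/(ev (cut (a%:Z - d%:Z - 1) (ev (vrow a d (a + j)))) x).
rewrite (ev_top H) ?ev_shift ?addnS.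
  by congr (if _ <= x then _ else _); lia.
by have -> : a%:Z - d%:Z - 1 - a%:Z = - d%:Z - 1 by [lia]; apply: iter_ev_odd0.
Qed.

Lemma hrow_top a d j x :
  hrow a d (a + j) x
  = if a%:Z - d%:Z <= x then iter (d + d).+1 ev (odd_dlt j) (x - a%:Z) else 0.
Proof. by rewrite /hrow (cut_ev_top (vrow_top a d j)) ev_shift. Qed.

Lemma ev_shiftN n j (t : int) x :
  ev (fun y => - iter n ev (odd_dlt j) (y - t)) x
  = - iter n.+1 ev (odd_dlt j) (x - t).
Proof. by rewrite /= /ev opprD addrAC. Qed.

(** The sign appears because below the axis [odd_dlt j] starts as minus the delta at [-1 - j]. *)
Lemma vrow_bot a d j x : (j < a)%N -> vrow a d (a - j.+1) x
  = if x < a%:Z - d%:Z then - iter (d + d) ev (odd_dlt j) (x - a%:Z) else 0.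
Proof.
move=> lt_ja; elim: d x => [|d IH] x.
  rewrite /= subr0 /odd_dlt /dlt; case: ltP => le; last by rewrite gt_eqF //; lia.
  have -> : (x - a%:Z == j%:Z) = false by lia.
  by rewrite sub0r opprK; congr (_%:R); lia.
have H y : cut (a%:Z - d%:Z - 1) (ev (vrow a d (a - j.+1))) y
    = if y < a%:Z - d%:Z - 1
      then - iter (d + d).+1 ev (odd_dlt j) (y - a%:Z) else 0.
  by rewrite (cut_ev_bot IH) ev_shiftN.
rewrite -[LHS]/(ev (cut (a%:Z - d%:Z - 1) (ev (vrow a d (a - j.+1)))) x).
rewrite (ev_bot H) ?ev_shiftN ?addnS.
  by congr (if x < _ then _ else _); lia.
have -> : a%:Z - d%:Z - 1 - a%:Z = - d%:Z - 1 by lia.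
by rewrite iter_ev_odd0 oppr0.
Qed.

Lemma hrow_bot a d j x : (j < a)%N -> hrow a d (a - j.+1) x
  = if x < a%:Z - d%:Z - 1
    then - iter (d + d).+1 ev (odd_dlt j) (x - a%:Z) else 0.
Proof.
by move=> lt; rewrite /hrow (cut_ev_bot (fun y => vrow_bot d y lt)) ev_shiftN.
Qed.

(** By pigeonhole every permutation sends some row of [I] to a column of [J]. *)
Lemma det_zero_block n (A : 'M[rat]_n) (I J : {set 'I_n}) :
  (forall i j, i \in I -> j \in J -> A i j = 0) -> (n < #|I| + #|J|)%N ->
  \det A = 0.
Proof.
move=> A0 lt; rewrite /determinant big1 // => s _.
have [i iI iJ] : exists2 i, i \in I & s i \in J.
  apply/exists_inP; rewrite -[X in is_true X]negbK negb_exists_in.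
  apply/negP => /forall_inP H.
  have sub : s @: I \subset ~: J.
    by apply/subsetP => _ /imsetP[i iI ->]; rewrite inE H.
  have := subset_leq_card sub; rewrite card_imset; last exact: perm_inj.
  by have := cardsC J; rewrite card_ord; lia.
by rewrite (bigD1 i) //= A0 // mul0r mulr0.
Qed.

Lemma card_ord_lt n m : (m <= n)%N -> #|[set i : 'I_n | (i < m)%N]| = m.
Proof.
move=> le; rewrite cardsE -sum1_card (big_ord_narrow le) sum1_card.
by rewrite card_ord.
Qed.

Lemma card_ord_ge n m :
  (m <= n)%N -> #|~: [set i : 'I_n | (i < m)%N]| = (n - m)%N.
Proof. by move=> le; rewrite cardsCs setCK card_ord card_ord_lt. Qed.

Lemma det_rev n (A : 'M[rat]_n) :
  \det (\matrix_(i, j) A (rev_ord i) (rev_ord j)) = \det A.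
Proof.
pose s : 'S_n := perm (can_inj (@rev_ordK n)).
have -> : (\matrix_(i, j) A (rev_ord i) (rev_ord j))
    = perm_mx s *m A *m (perm_mx s)^T.
  rewrite tr_perm_mx -col_permE -row_permE.
  by apply/matrixP => i j; rewrite !mxE !permE.
by rewrite !det_mulmx det_tr mulrAC det_perm -expr2 sqrr_sign mul1r.
Qed.

Lemma wdet_rev w F G s t :
  (forall k l, (k < w)%N -> (l < w)%N ->
     F k (s + l%:Z) = G (w - k.+1)%N (t + (w - l.+1)%N%:Z)) ->
  wdet w F s = wdet w G t.
Proof.
move=> eqFG; rewrite /wdet -[RHS]det_rev; congr (\det _).
by apply/matrixP => l k; rewrite !mxE eqFG.
Qed.

Lemma wdet_split a1 a2 F s :
  (forall k l, (k < a2)%N -> (l < a1)%N -> F (a1 + k)%N (s + l%:Z) = 0) ->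
  wdet (a1 + a2) F s = wdet a1 F s * wdet a2 (fun k => F (a1 + k)%N) (s + a1%:Z).
Proof.
move=> F0; rewrite /wdet.
set A := (X in \det X = _).
rewrite -[A]submxK.
have -> : ursubmx A = 0 by apply/matrixP => l k; rewrite !mxE /= F0.
rewrite det_lblock; congr (_ * _); congr (\det _); apply/matrixP => l k.
  by rewrite !mxE.
by rewrite !mxE /= PoszD addrA.
Qed.

(** The lowest reachable window forces every step down; on its rows [ev] acts by a unitriangular
    matrix. *)
Lemma pdet_left a F r s :
  (forall k x, (k < a)%N -> x < s -> F k x = 0) ->
  pdet a F r (s - r%:Z) = wdet a F s.
Proof.
move=> F0; elim: r => [|r IH]; first by rewrite subr0.
rewrite -IH /pdet -[RHS]wdet_rows_low; congr (\det _); apply/matrixP => l k.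
rewrite !mxE /= /ev addrC; congr (_ + _); first by congr (iter _ _ _ _); lia.
case: eqP => [->|_]; last by congr (iter _ _ _ _); lia.
have [|H _] := @iter_ev_left r (F k) s; last by rewrite H //; lia.
by move=> x lt; rewrite F0.
Qed.

(** In this lowest window the upper [a] paths only step down after the wall, while the lower rows
    are read only where the truncation in [vrow_bot] has no effect, so they evolve as odd functions
    for all [2d + c] steps. *)
Lemma pdet_even_base a d c :
  pdet (a + a) (vrow a d) c (- (d + c)%N%:Z) = evenval a d 0 c.
Proof.
rewrite evenval_base mulrC /pdet wdet_split => [|k l lt_k lt_l].
  congr (_ * _).
    rewrite -pdet_symp; apply: wdet_rev => k l lt_k lt_l.
    have -> : k = (a - (a - k.+1).+1)%N by lia.
    have lt : (a - k.+1 < a)%N by lia.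
    rewrite (iter_ev_local (g := fun y =>
      - iter (d + d) ev (odd_dlt (a - k.+1)) (y - a%:Z))).
      rewrite iter_ev_opp iter_ev_shift -iterD iter_ev_odd opprK.
      have -> : (a - (a - (a - k.+1).+1).+1 = a - k.+1)%N by lia.
      by rewrite [(c + _)%N]addnC; congr (iter _ _ _ _); lia.
    by move=> y _ le; rewrite vrow_bot // ifT //; lia.
  have -> : - (d + c)%N%:Z + a%:Z = a%:Z - d%:Z - c%:Z by lia.
  rewrite -/(pdet a (fun k => vrow a d (a + k)) c _) pdet_left.
    rewrite -pdet_symp addn0; apply: eq_wdet => k l lt_k lt_l.
    by rewrite vrow_top ifT; [congr (iter _ _ _ _)|]; lia.
  by move=> k x _ lt; rewrite vrow_top ifF //; lia.
have [|H _] := @iter_ev_left c (vrow a d (a + k)) (a%:Z - d%:Z).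
  by move=> x lt; rewrite vrow_top ifF //; lia.
by apply: H; lia.
Qed.

(** Row [a] of the window is the wall cell, where every [hrow] is cut, so only the entry of the tip
    survives in it. Its column is the last and its row the middle one, whence [(-1) ^+ a]; the minor
    splits into two mirror images. *)
Lemma pdet_odd_base a d :
  pdet (a + a).+1 (brow a d) 0 (- d%:Z - 1) = (-1) ^+ a * oddval a d 0 0.
Proof.
rewrite oddval_base expr2 /pdet /wdet.
have lt_a : (a < (a + a).+1)%N by lia.
rewrite (expand_det_row _ (Ordinal lt_a)) (bigD1 ord_max) //= big1 ?addr0;
  last first.
  move=> k ne; rewrite mxE /= /brow ifT; last first.
    by have := ltn_ord k; move/eqP: ne => ne lt; have : nat_of_ord k <> (a + a)%N;
      [move=> e; apply: ne; apply: val_inj|lia].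
  by rewrite /hrow /cut ifT ?mul0r //; lia.
rewrite mxE /= /brow ltnn /dlt /=.
have -> : (- d%:Z - 1 + a%:Z == a%:Z - d%:Z - 1) = true by lia.
rewrite mul1r /cofactor /= -signr_odd oddD oddD addbb addbF signr_odd.
congr (_ * _).
set A := (X in \det X = _).
have E (l : 'I_(a + a)) (k : 'I_(a + a)) :
  A l k = hrow a d k (- d%:Z - 1 + (l + (a <= l))%N%:Z).
  rewrite !mxE /= /brow /bump /=.
  have -> : (a + a <= k)%N = false by rewrite leqNgt ltn_ord.
  by rewrite add0n ltn_ord addnC.
clearbody A; rewrite -[A]submxK.
have -> : ursubmx A = 0.
  apply/matrixP => l k; rewrite !mxE E /= hrow_top ifF //.
  by have := ltn_ord l; lia.
rewrite det_lblock; congr (_ * _).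
  transitivity (wdet a (hrow a d) (- d%:Z - 1)).
    congr (\det _); apply/matrixP => l k; rewrite !mxE E /=.
    by rewrite leqNgt ltn_ord addn0.
  rewrite -pdet_symp addn1; apply: wdet_rev => k l lt_k lt_l.
  have -> : k = (a - (a - k.+1).+1)%N by lia.
  rewrite hrow_bot; last by lia.
  rewrite ifT; last by lia.
  rewrite iter_ev_odd opprK.
  have -> : (a - (a - (a - k.+1).+1).+1 = a - k.+1)%N by lia.
  by congr (iter _ _ _ _); lia.
transitivity (wdet a (fun k => hrow a d (a + k)) (a%:Z - d%:Z)).
  congr (\det _); apply/matrixP => l k; rewrite !mxE E /=.
  by congr (hrow _ _ _ _); lia.
rewrite -pdet_symp addn1; apply: eq_wdet => k l lt_k lt_l.
by rewrite hrow_top ifT; [congr (iter _ _ _ _)|]; lia.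
Qed.

Lemma wdet_add_last w F G (t : nat -> rat) s :
  (forall k x, (k < w)%N -> G k x = F k x + t k * F w x) ->
  (forall x, G w x = F w x) -> wdet w.+1 G s = wdet w.+1 F s.
Proof.
move=> GE Gw.
pose U : 'M[rat]_w.+1 := \matrix_(i, j)
  ((i == j)%:R + (if (i == w :> nat) && (j < w)%N then t j else 0)).
rewrite -[RHS]mulr1.
have <- : \det U = 1.
  rewrite det_trig ?big1 // => [i _|].
    rewrite mxE eqxx ifF ?addr0 //.
    by case: eqP => [->|//]; rewrite ltnn.
  apply/is_trig_mxP => i j lt; rewrite mxE -val_eqE ltn_eqF //= ifF ?addr0 //.
  by have := ltn_ord j; lia.
rewrite -det_mulmx; congr (\det _); apply/matrixP => l k; rewrite !mxE.
under eq_bigr do rewrite !mxE mulrDr.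
rewrite big_split /= (bigD1 k) //= eqxx mulr1 big1 ?addr0; last first.
  by move=> i /negbTE ->; rewrite mulr0.
rewrite big_ord_recr /= big1 ?add0r; last first.
  by move=> i _; rewrite /= ltn_eqF ?mulr0.
rewrite eqxx /=; case: ifP => [lt|ge]; first by rewrite GE // mulrC.
rewrite mulr0 addr0; have -> : nat_of_ord k = w by have := ltn_ord k; lia.
exact: Gw.
Qed.

Definition oddrow (a d k : nat) : int -> rat :=
  if (k < a + a)%N then ev (vrow a d k) else dlt (a%:Z - d%:Z - 1).

(** [hrow] and [ev (vrow a d k)] differ only at the tip cell, hence by a multiple of the delta in
    the last column; [ev] is linear, so this persists at later lines. *)
Lemma pdet_oddrow a d n s :
  pdet (a + a).+1 (oddrow a d) n s = pdet (a + a).+1 (brow a d) n s.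
Proof.
rewrite /pdet; apply: (@wdet_add_last _ _ _
  (fun k => ev (vrow a d k) (a%:Z - d%:Z - 1))) => [k x lt|x].
  rewrite /oddrow /brow lt ltnn -iter_ev_lin /hrow; apply: iter_ev_local.
  move=> y _ _; rewrite /cut /dlt; case: eqP => [->|_].
    by rewrite mulr1 add0r.
  by rewrite mulr0 addr0.
by rewrite /oddrow /brow ltnn.
Qed.

Lemma eq_pdet w F G n s : (forall k, (k < w)%N -> F k = G k) ->
  pdet w F n s = pdet w G n s.
Proof. by move=> e; apply: eq_wdet => k l lt _; rewrite e. Qed.

(** * The two relations and the induction on the wall length *)

Lemma pdet_rel_same a d n s :
  pdet (a + a).+1 (brow a d) n.+1 s * pdet (a + a) (vrow a d) n.+1 (s + 1)
  = pdet (a + a).+1 (brow a d) n s * pdet (a + a) (vrow a d) n.+2 (s + 1)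
    + pdet (a + a).+1 (brow a d) n (s + 1) * pdet (a + a) (vrow a d) n.+2 s.
Proof.
have E m x : pdet (a + a) (oddrow a d) m x = pdet (a + a) (vrow a d) m.+1 x.
  rewrite (@eq_pdet _ _ (fun k => ev (vrow a d k))).
    by apply: eq_wdet => k l _ _; rewrite iterSr.
  by move=> k lt; rewrite /oddrow lt.
by have := pdet_flag (a + a) (oddrow a d) n s; rewrite !pdet_oddrow !E.
Qed.

(** Without its last column [brow] is [hrow], which is one [ev] away from [vrow a d.+1]; for
    [oddrow] it was [ev] of [vrow a d]. *)
Lemma pdet_rel_next a d n s :
  pdet (a + a).+1 (brow a d) n.+2 s * pdet (a + a) (vrow a d.+1) n (s + 1)
  = pdet (a + a).+1 (brow a d) n.+1 s * pdet (a + a) (vrow a d.+1) n.+1 (s + 1)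
    + pdet (a + a).+1 (brow a d) n.+1 (s + 1) * pdet (a + a) (vrow a d.+1) n.+1 s.
Proof.
have E m x : pdet (a + a) (brow a d) m.+1 x = pdet (a + a) (vrow a d.+1) m x.
  rewrite (@eq_pdet _ _ (hrow a d)).
    by apply: eq_wdet => k l _ _; rewrite iterSr.
  by move=> k lt; rewrite /brow lt.
by have := pdet_flag (a + a) (brow a d) n.+1 s; rewrite !E.
Qed.

(** The boundary value [b = -1] of the relation: the lowest [a.+1] end points are out of reach for
    the upper paths and the tip, which make up [a.+1] columns. *)
Lemma pdet_brow_low a d n :
  pdet (a + a).+1 (brow a d) n (- (d + n)%N%:Z - 2) = 0.
Proof.
pose I := [set i : 'I_(a + a).+1 | (i < a.+1)%N].
pose J := [set i : 'I_(a + a).+1 | (a <= i)%N].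
apply: (@det_zero_block _ _ I J) => [l k|].
  rewrite !inE mxE => lt_l le_k.
  have [|H _] := @iter_ev_left n (brow a d k) (a%:Z - d%:Z - 1).
    move=> x lt; rewrite /brow; case: ifP => lt2.
      by rewrite -(subnKC le_k) hrow_top ifF //; lia.
    by rewrite /dlt lt_eqF.
  by apply: H; lia.
have cI : #|I| = a.+1 by rewrite card_ord_lt //; lia.
have -> : J = ~: [set i : 'I_(a + a).+1 | (i < a)%N].
  by apply/setP => i; rewrite !inE -leqNgt.
rewrite cI card_ord_ge; lia.
Qed.

(** The boundary value [c = -1], with the highest [a.+1] end points against the lower paths and the
    tip. *)
Lemma pdet_brow_high a d n : pdet (a + a).+1 (brow a d) n (- d%:Z) = 0.
Proof.
pose I := ~: [set i : 'I_(a + a).+1 | (i < a)%N].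
pose J := ord_max |: [set i : 'I_(a + a).+1 | (i < a)%N].
apply: (@det_zero_block _ _ I J) => [l k|].
  rewrite !inE mxE -leqNgt => le_l lt_k.
  have [|H _] := @iter_ev_right n (brow a d k) (a%:Z - d%:Z - 1).
    move=> x lt; rewrite /brow; case: ifP => lt2; last by rewrite /dlt gt_eqF.
    case/orP: lt_k => [/eqP e|lt_k]; first by move: lt2; rewrite e /= ltnn.
    have -> : nat_of_ord k = (a - (a - k.+1).+1)%N by lia.
    by rewrite hrow_bot ?ifF //; lia.
  by apply: H; lia.
rewrite card_ord_ge ?cardsU1 ?card_ord_lt ?inE /=; lia.
Qed.

Lemma odd_even_shiftr a d b c :
  oddval a d b c * evenval a d b c.+2 * (b + c).+1%:R
  = oddval a d b c.+1 * evenval a d b c.+1 * c.+1%:R.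
Proof.
rewrite !(oddval_sym _ _ b) !(evenval_sym _ _ b) -odd_even_shift.
by rewrite [(c + b)%N]addnC.
Qed.

(** Induction on the number [b + c] of steps after the wall. The relation is divided by the known
    [A_d(b, c)]; at [b = 0] or [c = 0] one product drops out. *)
Lemma pdet_odd_of_even a d :
  (forall b c, pdet (a + a) (vrow a d) (b + c) (- (d + c)%N%:Z)
               = evenval a d b c) ->
  forall b c, pdet (a + a).+1 (brow a d) (b + c) (- (d + c)%N%:Z - 1)
              = (-1) ^+ a * oddval a d b c.
Proof.
move=> valA b c; move: {2}(b + c)%N (erefl (b + c)%N) => n.
elim: n b c => [|n IH] b c bc.
  have -> : b = 0%N by lia.
  have -> : c = 0%N by lia.
  by rewrite !addn0 pdet_odd_base.
have := pdet_rel_same a d n (- (d + c)%N%:Z - 1).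
have -> : - (d + c)%N%:Z - 1 + 1 = - (d + c)%N%:Z by lia.
have -> : - (d + c)%N%:Z - 1 = - (d + c.+1)%N%:Z by lia.
have -> : pdet (a + a) (vrow a d) n.+1 (- (d + c)%N%:Z) = evenval a d b c.
  by rewrite -valA; congr (pdet _ _ _ _); lia.
have -> : pdet (a + a) (vrow a d) n.+2 (- (d + c)%N%:Z) = evenval a d b.+1 c.
  by rewrite -valA; congr (pdet _ _ _ _); lia.
have -> : pdet (a + a) (vrow a d) n.+2 (- (d + c.+1)%N%:Z)
    = evenval a d b c.+1.
  by rewrite -valA; congr (pdet _ _ _ _); lia.
rewrite bc.
have -> : pdet (a + a).+1 (brow a d) n (- (d + c.+1)%N%:Z)
    = if b is b'.+1 then (-1) ^+ a * oddval a d b' c else 0.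
  case: b bc => [|b] bc.
    by rewrite -[RHS](pdet_brow_low a d n); congr (pdet _ _ _ _); lia.
  rewrite -IH; last by lia.
  by congr (pdet _ _ _ _); lia.
have -> : pdet (a + a).+1 (brow a d) n (- (d + c)%N%:Z)
    = if c is c'.+1 then (-1) ^+ a * oddval a d b c' else 0.
  case: c bc => [|c] bc.
    by rewrite -[RHS](pdet_brow_high a d n) addn0.
  rewrite -IH; last by lia.
  by congr (pdet _ _ _ _); lia.
move=> R; apply: (mulIf (evenval_neq0 a d b c)); rewrite {}R.
case: b c bc => [|b] [|c] bc; first by lia.
- have n1 : c.+1%:R != 0 :> rat by rewrite pnatr_eq0.
  rewrite mul0r add0r; apply: (mulIf n1).
  have := odd_even_shiftr a d 0 c; rewrite add0n => e.
  transitivity ((-1) ^+ a * (oddval a d 0 c * evenval a d 0 c.+2 * c.+1%:R)).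
    by ring.
  by rewrite e; ring.
- have n1 : b.+1%:R != 0 :> rat by rewrite pnatr_eq0.
  rewrite mul0r addr0; apply: (mulIf n1).
  have := odd_even_shift a d b 0; rewrite addn0 => e.
  transitivity ((-1) ^+ a * (oddval a d b 0 * evenval a d b.+2 0 * b.+1%:R)).
    by ring.
  by rewrite e; ring.
have n1 : (b + c).+2%:R != 0 :> rat by rewrite pnatr_eq0.
apply: (mulIf n1).
have := odd_even_shift a d b c.+1; have := odd_even_shiftr a d b.+1 c.
rewrite addnS addSn => e1 e2.
transitivity ((-1) ^+ a *
  (oddval a d b c.+1 * evenval a d b.+2 c.+1 * (b + c).+2%:R
   + oddval a d b.+1 c * evenval a d b.+1 c.+2 * (b + c).+2%:R)).
  by ring.
by rewrite e1 e2; ring.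
Qed.

Lemma odd_even_nextr a d b c :
  oddval a d b.+1 c * evenval a d.+1 b c.+1 * (b + c + a + a).+2%:R
  = oddval a d b.+1 c.+1 * evenval a d.+1 b c * (c + a).+1%:R.
Proof.
rewrite !(oddval_sym _ _ b.+1) !(evenval_sym _ _ b) -odd_even_next.
by rewrite [(c + b)%N]addnC.
Qed.

(** Here the relation is solved for the factor [A_(d+1)] at [b.+1], so the induction is on [b]
    alone, for all [c]. *)
Lemma pdet_even_of_odd a d :
  (forall b c, pdet (a + a).+1 (brow a d) (b + c) (- (d + c)%N%:Z - 1)
               = (-1) ^+ a * oddval a d b c) ->
  forall b c, pdet (a + a) (vrow a d.+1) (b + c) (- (d.+1 + c)%N%:Z)
              = evenval a d.+1 b c.
Proof.
move=> valB; elim=> [|b IH] c; first exact: pdet_even_base.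
have := pdet_rel_next a d (b + c) (- (d.+1 + c)%N%:Z - 1).
have -> : - (d.+1 + c)%N%:Z - 1 + 1 = - (d.+1 + c)%N%:Z by lia.
have -> : - (d.+1 + c)%N%:Z - 1 = - (d.+1 + c.+1)%N%:Z by lia.
have -> : pdet (a + a).+1 (brow a d) (b + c).+2 (- (d.+1 + c.+1)%N%:Z)
    = (-1) ^+ a * oddval a d b.+1 c.+1.
  by rewrite -valB; congr (pdet _ _ _ _); lia.
have -> : pdet (a + a).+1 (brow a d) (b + c).+1 (- (d.+1 + c.+1)%N%:Z)
    = (-1) ^+ a * oddval a d b c.+1.
  by rewrite -valB; congr (pdet _ _ _ _); lia.
have -> : pdet (a + a).+1 (brow a d) (b + c).+1 (- (d.+1 + c)%N%:Z)
    = (-1) ^+ a * oddval a d b.+1 c.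
  by rewrite -valB; congr (pdet _ _ _ _); lia.
have -> : pdet (a + a) (vrow a d.+1) (b + c).+1 (- (d.+1 + c.+1)%N%:Z)
    = evenval a d.+1 b c.+1.
  by rewrite -IH; congr (pdet _ _ _ _); lia.
rewrite IH -addSn => R0.
have {R0}R : oddval a d b.+1 c.+1 * evenval a d.+1 b c
  = oddval a d b c.+1 * pdet (a + a) (vrow a d.+1) (b.+1 + c) (- (d.+1 + c)%N%:Z)
    + oddval a d b.+1 c * evenval a d.+1 b c.+1.
  apply: (mulrI (unitrX a (unitrN1 _))).
  by rewrite mulrDr [LHS]mulrA [X in _ = X + _]mulrA [X in _ = _ + X]mulrA.
have n0 := oddval_neq0 a d b c.+1.
have n1 : (b + c + a + a).+2%:R != 0 :> rat by rewrite pnatr_eq0.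
apply: (mulfI n0); apply/(@addIr _ (oddval a d b.+1 c * evenval a d.+1 b c.+1)).
rewrite -R; apply: (mulIf n1).
rewrite mulrDl odd_even_next odd_even_nextr; ring.
Qed.

Lemma pdet_evenval a d b c :
  pdet (a + a) (vrow a d) (b + c) (- (d + c)%N%:Z) = evenval a d b c.
Proof.
elim: d b c => [|d IH] b c; first by rewrite evenval_mac add0n -pdet_mac.
by apply: pdet_even_of_odd; apply: pdet_odd_of_even.
Qed.

Lemma pdet_oddval a d b c :
  pdet (a + a).+1 (brow a d) (b + c) (- (d + c)%N%:Z - 1)
  = (-1) ^+ a * oddval a d b c.
Proof. by apply: pdet_odd_of_even => *; apply: pdet_evenval. Qed.

(** * From tilings to determinants *)

Local Open Scope nat_scope.

Section Tilings.

Variable N : nat.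
Implicit Types (R : {set tri N}) (T : {set {set tri N}}).

Lemma share_edge_sym (x y : tri N) : share_edge x y -> share_edge y x.
Proof.
rewrite /share_edge eq_sym => /andP[-> /=] /eqP <-.
apply/eqP; rewrite !size_filter.
have uv (t : tri N) : uniq (verts t).
  by case: t => [[[] i] j] /=; rewrite !inE !xpair_eqE; lia.
by rewrite -!size_filter; apply/perm_size/uniq_perm; rewrite ?filter_uniq // => v;
  rewrite !mem_filter andbC.
Qed.

Lemma lozengeP (L : {set tri N}) x : is_lozenge L -> x \in L ->
  exists2 y, share_edge x y & L = [set x; y].
Proof.
case/existsP => t1 /existsP[t2 /andP[e /eqP->]]; rewrite !inE.
case/orP => /eqP->; first by exists t2.
by exists t1; [apply: share_edge_sym | rewrite setUC].
Qed.

Lemma M_set0 : M (set0 : {set tri N}) = 1.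
Proof.
rewrite /M -(cards1 (set0 : {set {set tri N}})); apply: eq_card => T.
rewrite !inE /lozenge_tiling partition_set0.
by case: eqP => //= ->; apply/forall_inP => L; rewrite inE.
Qed.

(** Tilings are sorted by the partner of [x]; deleting the block [[set x; y]] is a bijection onto
    the tilings of the rest. *)
Lemma M_expand R x : x \in R ->
  M R = \sum_(y in R | share_edge x y) M (R :\: [set x; y]).
Proof.
move=> xR; rewrite /M -sum1_card.
transitivity (\sum_(T in [set T | lozenge_tiling R T])
   \sum_(y in R | share_edge x y) ([set x; y] \in T)).
  apply: eq_bigr => T; rewrite inE => /andP[partT /forall_inP lozT].
  have covT := cover_partition partT.
  have Bx : pblock T x \in T by rewrite pblock_mem ?covT.
  have xB : x \in pblock T x by rewrite mem_pblock covT.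
  have [y exy def_B] := lozengeP (lozT _ Bx) xB.
  have yR : y \in R.
    by apply: (subsetP (partitionS partT Bx)); rewrite def_B !inE eqxx orbT.
  rewrite (bigD1 y) /=; last by rewrite yR exy.
  rewrite -def_B Bx big1 // => z /andP[/andP[_ exz] ne_zy].
  apply/eqP; rewrite eqb0; apply/negP => Bz.
  have : [set x; z] = [set x; y].
    rewrite -def_B; apply/esym/(def_pblock (partition_trivIset partT) Bz).
    by rewrite !inE eqxx.
  move/setP/(_ z); rewrite !inE eqxx orbT (negbTE ne_zy) orbF => /esym/eqP e.
  by move: exz; rewrite e /share_edge eqxx.
rewrite exchange_big /=; apply: eq_bigr => y /andP[yR exy].
pose B := [set x; y].
transitivity (\sum_(T | (T \in [set T | lozenge_tiling R T]) && (B \in T)) 1).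
  by rewrite [RHS]big_mkcondr; apply: eq_bigr => T _; rewrite /B; case: (_ \in T).
have B0 : B != set0 by apply/set0Pn; exists x; rewrite !inE eqxx.
have sBR : B \subset R by apply/subsetP => z; rewrite !inE => /orP[] /eqP->.
rewrite (reindex_onto (fun T => B |: T) (fun T => T :\ B)) /=; last first.
  by move=> T /andP[_ BT]; rewrite setD1K.
rewrite sum1_card; apply: eq_card => T.
rewrite [LHS]unfold_in !inE eqxx andbT.
apply/idP/idP => [/andP[/andP[partT /forall_inP lozT] /eqP def_T]|].
  apply/andP; split.
    by have := partitionD1 partT (setU11 B T); rewrite def_T.
  apply/forall_inP => L LT; apply: lozT.
  by rewrite !inE LT orbT.
case/andP => partT /forall_inP lozT.
have BT : B \notin T.
  apply/negP => BT; have := subsetP (partitionS partT BT) x.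
  by rewrite !inE eqxx => /(_ isT).
apply/andP; split; last first.
  by rewrite setU1K.
apply/andP; split.
  have := partitionU1 partT B0.
  have -> : B :|: (R :\: B) = R by rewrite -{2}(setID R B) (setIidPr sBR).
  move=> H; apply: H; apply/pred0P => z /=; rewrite [z \in _ :\: _]inE.
  by case: (z \in B).
apply/forall_inP => L; rewrite !inE => /predU1P[->|/lozT //].
by apply/existsP; exists x; apply/existsP; exists y; rewrite exy /=.
Qed.

End Tilings.

Section Region.

Variable N : nat.

Lemma share_edge_same (r : bool) (i j k l : 'I_N) :
  share_edge ((r, i, j) : tri N) (r, k, l) = false.
Proof.
rewrite /share_edge -[_ == _]/((r, i, j) == (r, k, l)) !xpair_eqE eqxx /=.
rewrite -!val_eqE /= size_filter.
by case: r => /=; rewrite !inE !xpair_eqE; lia.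
Qed.

Lemma share_edgeLR (i j k l : 'I_N) :
  share_edge ((false, i, j) : tri N) (true, k, l)
  = (k == i :> nat) && ((l == j :> nat) || (l == j.+1 :> nat))
    || (k == i.+1 :> nat) && (l == j :> nat).
Proof.
rewrite /share_edge size_filter /= !inE !xpair_eqE.
lia.
Qed.

Implicit Types P Q : bool -> nat -> nat -> bool.

Definition mu P : nat := M [set t : tri N | P t.1.1 t.1.2 t.2].

Definition del P (r : bool) (i j : nat) : bool -> nat -> nat -> bool :=
  fun r' i' j' => P r' i' j' && ~~ [&& r' == r, i' == i & j' == j].

Lemma eq_mu P P' : (forall r i j, P r i j = P' r i j) -> mu P = mu P'.
Proof. by move=> e; congr (M _); apply/setP => t; rewrite !inE. Qed.

Lemma mu0 P : (forall r i j, P r i j = false) -> mu P = 1.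
Proof.
by move=> e; rewrite -(M_set0 N); congr (M _); apply/setP => t; rewrite !inE.
Qed.

Lemma del2_set P (x y : tri N) :
  [set t : tri N | P t.1.1 t.1.2 t.2] :\: [set x; y]
  = [set t : tri N | del (del P x.1.1 x.1.2 x.2) y.1.1 y.1.2 y.2
                       t.1.1 t.1.2 t.2].
Proof.
apply/setP => t; rewrite !inE /del -andbA andbC -negb_or.
case: x y t => [[r1 i1] j1] [[r2 i2] j2] [[r i] j] /=.
by rewrite -[(r, i, j) == (r1, i1, j1)]/(((r == r1) && (i == i1)) && (j == j1))
  -[(r, i, j) == (r2, i2, j2)]/(((r == r2) && (i == i2)) && (j == j2))
  -!val_eqE -!andbA.
Qed.

Lemma sum_two (T : finType) (A : pred T) (F : T -> nat) y1 y2 :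
  y1 != y2 -> (forall y, A y -> (y == y1) || (y == y2)) ->
  \sum_(y | A y) F y = A y1 * F y1 + A y2 * F y2.
Proof.
move=> ne sub; rewrite big_mkcond (bigD1 y1) //= (bigD1 y2) 1?eq_sym //=.
rewrite big1 ?addn0 => [|y /andP[n1 n2]]; last first.
  by case: ifP => // /sub; rewrite (negbTE n1) (negbTE n2).
by do 2?case: ifP; rewrite ?mul1n ?mul0n.
Qed.

(** The third neighbour of a left-pointing triangle lies in the next strip, across their vertical
    edge; once it is gone, two partners remain. *)
Lemma mu_L P t b : t < N -> b.+1 < N -> P false t b -> P true t.+1 b = false ->
  mu P = P true t b * mu (del (del P false t b) true t b)
       + P true t b.+1 * mu (del (del P false t b) true t b.+1).
Proof.
move=> tN bN Pb Pn; pose b0 := Ordinal (ltnW bN); pose b1 := Ordinal bN.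
pose t0 := Ordinal tN; pose x : tri N := (false, t0, b0).
rewrite /mu (@M_expand _ _ x) ?inE //.
rewrite (@sum_two _ _ _ ((true, t0, b0) : tri N) ((true, t0, b1) : tri N)).
- rewrite !inE /= !share_edgeLR /= !eqxx orbT /= !andbT.
  by rewrite !del2_set.
- by rewrite -[_ == _]/((true, t0, b0) == (true, t0, b1)) xpair_eqE -!val_eqE /=; lia.
case=> [[[] i] j]; rewrite inE /= ?share_edge_same ?andbF // share_edgeLR /=.
rewrite -[_ == (_, b0)]/((true, i, j) == (true, t0, b0)).
rewrite -[_ == (_, b1)]/((true, i, j) == (true, t0, b1)).
rewrite !xpair_eqE -!val_eqE /=.
case/andP => Pij /orP[]; first by lia.
by case/andP => /eqP ei /eqP ej; move: Pij; rewrite ei ej Pn.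
Qed.

Lemma mu_R P t a : t.+1 < N -> a < N -> P true t.+1 a ->
  (forall j, P false t.+1 j = false) ->
  mu P = P false t a * mu (del (del P true t.+1 a) false t a).
Proof.
move=> tN aN Pa Pn; pose a0 := Ordinal aN.
pose t1 := Ordinal tN; pose t0 := Ordinal (ltnW tN).
pose x : tri N := (true, t1, a0).
pose y : tri N := (false, t0, a0).
rewrite /mu (@M_expand _ _ x) ?inE //.
have exy : share_edge x y.
  by apply: share_edge_sym; rewrite share_edgeLR /= !eqxx orbT.
rewrite (@sum_two _ _ _ y x) //.
- by rewrite !inE /= exy /share_edge eqxx /= !andbF mul0n addn0 andbT del2_set.
case=> [[[] i] j]; rewrite inE /= ?share_edge_same ?andbF //.
case/andP=> Pij /share_edge_sym; rewrite share_edgeLR /=.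
rewrite -[_ == y]/((false, i, j) == (false, t0, a0)) !xpair_eqE -!val_eqE /=.
case/orP; last by case/andP => /eqP[->] /eqP->; rewrite !eqxx.
by case/andP => /eqP ei _; move: Pij; rewrite -ei Pn.
Qed.

End Region.

Section Strips.

Variables (N : nat) (Q : bool -> nat -> nat -> bool).

(* Strips before [t] are intact; in strip [t] the right-pointing triangles in [C]
are gone and only the left-pointing ones in [s] are left. *)
Definition front (t : nat) (C s : seq nat) : bool -> nat -> nat -> bool :=
  fun r i j => if i < t then Q r i j else
    (i == t) && (if r then Q true i j && (j \notin C) else j \in s).

(** The two partners are the two steps of a path across strip [t]: a position leaves [s], on line
    [t + 1], and enters [C], on line [t]. *)
Lemma front_expand t C s b : t < N -> b.+1 < N -> b \notin s ->
  mu N (front t C (rcons s b))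
  = (Q true t b && (b \notin C)) * mu N (front t (b :: C) s)
    + (Q true t b.+1 && (b.+1 \notin C)) * mu N (front t (b.+1 :: C) s).
Proof.
move=> tN bN nbs; rewrite (@mu_L _ _ t b) //; last 2 first.
- by rewrite /front ltnn eqxx mem_rcons mem_head.
- by rewrite /front ltnNge leqnSn /= gtn_eqF.
congr (_ * _ + _ * _).
- by rewrite /front ltnn eqxx.
- apply: eq_mu => r i j; rewrite /del /front; case: ltngtP => [lt|lt|->] /=.
  + by rewrite !andbF !andbT.
  + by [].
  case: r => /=; first by rewrite inE negb_or andbT -andbA [in RHS](andbC (j != b)).
  rewrite mem_rcons inE andbT; case: eqP => [->|_] /=; last by rewrite andbT.
  by rewrite (negbTE nbs).
- by rewrite /front ltnn eqxx.
apply: eq_mu => r i j; rewrite /del /front; case: ltngtP => [lt|lt|->] /=.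
+ by rewrite !andbF !andbT.
+ by [].
case: r => /=; first by rewrite inE negb_or andbT -andbA [in RHS](andbC (j != b.+1)).
rewrite mem_rcons inE andbT; case: eqP => [->|_] /=; last by rewrite andbT.
by rewrite (negbTE nbs).
Qed.

(* Strips up to [t] without the left-pointing triangles [A] of strip [t], plus the
right-pointing triangles [s] of strip [t + 1], each of which has at most one
possible partner. *)
Definition back (t : nat) (A s : seq nat) : bool -> nat -> nat -> bool :=
  fun r i j => if i < t then Q r i j else
    if i == t then (if r then Q true t j else Q false t j && (j \notin A))
    else [&& i == t.+1, r & j \in s].

Lemma back_forced t A s : t.+1 < N -> uniq s -> all (fun j => j < N) s ->
  ~~ has [in A] s ->
  mu N (back t A s) = all (Q false t) s * mu N (back t (s ++ A) [::]).
Proof.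
move=> tN; elim: s A => [|a s IH] A /=; first by rewrite mul1n.
case/andP=> nas us /andP[aN sN]; rewrite negb_or => /andP[naA nsA].
rewrite (@mu_R _ _ t a) //; last 2 first.
- by rewrite /back ltnNge leqnSn /= gtn_eqF // eqxx mem_head.
- by move=> j; rewrite /back ltnNge leqnSn /= gtn_eqF // andbF.
have -> : back t A (a :: s) false t a = Q false t a.
  by rewrite /back ltnn eqxx naA andbT.
rewrite -mulnb -mulnA; congr (_ * _).
rewrite (@eq_mu _ _ (back t (a :: A) s)) => [|r i j].
  rewrite IH //.
    congr (_ * _); apply: eq_mu => r i j; rewrite /back; case: ifP => // _.
    by rewrite [in LHS]mem_cat !inE mem_cat orbCA.
  apply/hasPn => j js /=; rewrite inE negb_or (hasPn nsA _ js) andbT.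
  by apply: contraNneq nas => <-.
rewrite /del /back; case: (ltngtP i t) => [lt|lt|->] /=.
- have -> : (i == t.+1) = false by lia.
  by rewrite !andbF !andbT.
- rewrite andbF andbT; case: eqP => //= _.
  case: r => //=; rewrite inE; case: eqP => //= [->|_]; last by rewrite andbT.
  by rewrite (negbTE nas).
have -> : (t == t.+1) = false by lia.
rewrite andbF andbT; case: r => /=; first by rewrite andbT.
by rewrite inE negb_or -andbA [(j \notin A) && _]andbC.
Qed.

(** A right-pointing triangle that no path uses must pair across the vertical line to its left; the
    count is 0 if such a partner is outside the region. *)
Lemma front_nil t C : t.+1 < N -> (forall j, Q true t.+1 j -> j < N) ->
  let s := [seq j <- iota 0 N | Q true t.+1 j & j \notin C] in
  mu N (front t.+1 C [::]) = all (Q false t) s * mu N (back t s [::]).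
Proof.
move=> tN QN s.
have sE j : (j \in s) = Q true t.+1 j && (j \notin C).
  rewrite mem_filter mem_iota /= add0n.
  by case: (boolP (Q _ _ _)) => //= /QN ->; rewrite andbT.
rewrite -[s in back t s]cats0 -back_forced //.
- apply: eq_mu => r i j; rewrite /front /back sE ltnS.
  case: ltngtP => [lt|lt|->] /=; [by []| |].
  + by case: eqP => //= ->; case: r; rewrite ?andbT ?andbF.
  by case: r; rewrite ?andbT.
- by rewrite filter_uniq ?iota_uniq.
- by apply/allP => j; rewrite sE => /andP[/QN].
exact/hasPn.
Qed.

Lemma front_nil_same t C : t.+1 < N -> (forall j, Q true t.+1 j -> j < N) ->
  (forall j, Q true t.+1 j = Q false t j) -> all (Q true t.+1) C ->
  mu N (front t.+1 C [::]) = mu N (front t [::] C).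
Proof.
move=> tN QN Qeq /allP QC; rewrite front_nil //; set s := filter _ _.
have sE j : (j \in s) = Q true t.+1 j && (j \notin C).
  rewrite mem_filter mem_iota /= add0n.
  by case: (boolP (Q _ _ _)) => //= /QN ->; rewrite andbT.
have -> : all (Q false t) s.
  by apply/allP => j; rewrite sE Qeq => /andP[].
rewrite mul1n; apply: eq_mu => r i j; rewrite /back /front.
case: ltngtP => //= [lt|->]; first by rewrite andbF andbF.
case: r; rewrite ?andbT // sE -Qeq.
case: (boolP (j \in C)) => [/QC ->|]; first by rewrite andbF.
by rewrite andbT; case: (Q _ _ _).
Qed.

(** At the tip the right-pointing triangle [j0] has no partner across the line, so a path has to
    start there. *)
Lemma front_nil_tip t C j0 : t.+1 < N -> (forall j, Q true t.+1 j -> j < N) ->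
  (forall j, Q true t.+1 j = Q false t j || (j == j0)) ->
  Q false t j0 = false -> all (Q true t.+1) C ->
  mu N (front t.+1 C [::])
  = (j0 \in C) * mu N (front t [::] [seq j <- C | j != j0]).
Proof.
move=> tN QN Qeq Q0 /allP QC; rewrite front_nil //; set s := filter _ _.
have sE j : (j \in s) = Q true t.+1 j && (j \notin C).
  rewrite mem_filter mem_iota /= add0n.
  by case: (boolP (Q _ _ _)) => //= /QN ->; rewrite andbT.
have -> : all (Q false t) s = (j0 \in C).
  apply/idP/idP => [/allP H|j0C].
    by apply/negPn/negP => n; have := H j0; rewrite sE Qeq eqxx orbT n Q0 => /(_ isT).
  apply/allP => j; rewrite sE Qeq => /andP[/orP[//|/eqP->]].
  by rewrite j0C.
congr (_ * _); apply: eq_mu => r i j; rewrite /back /front.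
case: ltngtP => //= [lt|->]; first by rewrite andbF andbF.
case: r; rewrite ?andbT // sE mem_filter Qeq.
case: eqP => [->|/eqP ne] /=; first by rewrite Q0.
rewrite orbF; case: (boolP (j \in C)) => [jC|]; last by rewrite andbT andbN.
by have := QC _ jC; rewrite Qeq (negbTE ne) orbF => ->.
Qed.

End Strips.

Local Open Scope ring_scope.

(** * Emptying a strip as an operation on the rows of a determinant *)

Definition ldet (w : nat) (L : seq (nat -> rat)) : rat :=
  \det (\matrix_(l < w, k < w) nth (fun=> 0) L l k).

Lemma ldet_add w (L1 L2 : seq (nat -> rat)) (u v : nat -> rat) :
  (size L1 < w)%N ->
  ldet w (L1 ++ (fun k => u k + v k) :: L2)
  = ldet w (L1 ++ u :: L2) + ldet w (L1 ++ v :: L2).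
Proof.
move=> lt; pose i0 := Ordinal lt.
rewrite /ldet -[X in _ = _ + X]mul1r -[X in _ = X + _]mul1r.
apply: (@determinant_multilinear _ _ _ _ _ i0).
- by apply/rowP => k; rewrite !mxE /= !nth_cat ltnn subnn /= !mul1r.
- apply/matrixP => i k; rewrite !mxE /= !nth_cat; case: ltnP => // ge.
  have := neq_lift i0 i; rewrite -val_eqE /= => ne.
  by have [m ->] : exists m, (bump (size L1) i - size L1 = m.+1)%N;
    [exists (bump (size L1) i - size L1).-1; lia|].
apply/matrixP => i k; rewrite !mxE /= !nth_cat; case: ltnP => // ge.
have := neq_lift i0 i; rewrite -val_eqE /= => ne.
by have [m ->] : exists m, (bump (size L1) i - size L1 = m.+1)%N;
  [exists (bump (size L1) i - size L1).-1; lia|].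
Qed.

Lemma ldet_dup w (L1 L2 : seq (nat -> rat)) (u : nat -> rat) :
  ((size L1).+1 < w)%N -> ldet w (L1 ++ u :: u :: L2) = 0.
Proof.
move=> lt; apply: (@determinant_alternate _ _ _ (Ordinal (ltnW lt)) (Ordinal lt)).
  by rewrite -val_eqE /= ltn_eqF.
move=> k; rewrite !mxE /= !nth_cat ltnn subnn ltnNge leqnSn /=.
by rewrite subSn // subnn.
Qed.

Lemma ldet_zero w (L1 L2 : seq (nat -> rat)) (u : nat -> rat) :
  (size L1 < w)%N -> (forall k, (k < w)%N -> u k = 0) ->
  ldet w (L1 ++ u :: L2) = 0.
Proof.
move=> lt u0; rewrite /ldet (expand_det_row _ (Ordinal lt)) big1 // => k _.
by rewrite mxE /= nth_cat ltnn subnn /= u0 ?mul0r.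
Qed.

Section StripDet.

Variables (N : nat) (Q : bool -> nat -> nat -> bool).
Variables (t w : nat) (F : nat -> int -> rat) (o : int) (sg : rat).
Hypothesis tN : (t < N)%N.
Hypothesis detC : forall C, sorted ltn C -> size C = w -> all (Q true t) C ->
  (mu N (front Q t C [::]))%:R
  = sg * ldet w [seq (fun k => F k (j%:Z - o)) | j <- C].

(** In the middle of a strip, the paths at [s] have yet to cross it and those at [C] have done so.
    Additivity in the row of the last element of [s] mirrors [front_expand]: a target outside the
    region gives a zero row, an occupied one two equal rows. Going from top to bottom keeps the
    positions sorted. *)
Lemma front_det_mixed s C : sorted ltn (s ++ C) -> (size s + size C = w)%N ->
  all (Q true t) C -> all (fun b => b.+1 < N)%N s ->
  (forall b j, b \in s -> (j == b) || (j == b.+1) -> ~~ Q true t j ->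
    forall k, (k < w)%N -> F k (j%:Z - o) = 0) ->
  (mu N (front Q t C s))%:R
  = sg * ldet w ([seq (fun k => ev (F k) (j%:Z - o)) | j <- s]
                 ++ [seq (fun k => F k (j%:Z - o)) | j <- C]).
Proof.
elim/last_ind: s C => [|s b IH] C srt sz QC sN F0.
  exact: detC.
have srt3 : sorted ltn (s ++ b :: C) by rewrite -cat_rcons.
have ltsb x : x \in s -> (x < b)%N.
  move: srt3; rewrite sorted_pairwise; last exact: ltn_trans.
  rewrite pairwise_cat => /and3P[/allrelP H _ _] xs.
  by apply: H => //; rewrite mem_head.
have ltbC x : x \in C -> (b < x)%N.
  move: srt3; rewrite sorted_pairwise; last exact: ltn_trans.
  rewrite pairwise_cat /= => /and3P[_ _ /andP[/allP H _]]; exact: H.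
have srtC : sorted ltn C.
  by have := cat_sorted2 srt => -[].
have srts : sorted ltn s.
  by have := cat_sorted2 srt3 => -[].
move: sN; rewrite all_rcons => /andP[bN sN].
rewrite size_rcons in sz.
have nbs : b \notin s by apply/negP => /ltsb; rewrite ltnn.
have nbC : b \notin C by apply/negP => /ltbC; rewrite ltnn.
rewrite front_expand // map_rcons cat_rcons /=.
rewrite -[fun k => ev (F k) (b%:Z - o)]/(fun k : nat =>
  F k (b%:Z - o) + F k (b%:Z - o + 1)).
rewrite ldet_add ?size_map; last by lia.
have F0s b' j : b' \in s -> (j == b') || (j == b'.+1) -> ~~ Q true t j ->
    forall k, (k < w)%N -> F k (j%:Z - o) = 0.
  by move=> b's; apply: F0; rewrite mem_rcons inE b's orbT.
rewrite mulrDr natrD !natrM; congr (_ + _).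
  rewrite nbC andbT; case: (boolP (Q true t b)) => [Qb|nQb] /=; last first.
    rewrite mul0r ldet_zero ?mulr0 ?size_map //; first by lia.
    by apply: (F0 b); rewrite ?mem_rcons ?mem_head ?eqxx.
  rewrite mul1r IH //=; first by rewrite addnS.
  by rewrite Qb.
have -> : b%:Z - o + 1 = b.+1%:Z - o by lia.
case: (boolP (Q true t b.+1)) => [Qb|nQb] /=; last first.
  rewrite mul0r ldet_zero ?mulr0 ?size_map //; first by lia.
  by apply: (F0 b); rewrite ?mem_rcons ?mem_head ?eqxx ?orbT.
(* Two paths collide. As [C] is sorted and lies above [b], the element [b.+1] is its head, so the
   equal rows are adjacent. *)
case: (boolP (b.+1 \in C)) => [bC|nbC1] /=.
  rewrite mul0r; case: C bC ltbC srtC sz {srt QC srt3 nbC IH} => // x C.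
  rewrite inE => /orP[/eqP <-|bC] ltbC srtC sz /=.
    by rewrite ldet_dup ?mulr0 // size_map /=; move: sz => /=; lia.
  move: srtC => /=; rewrite path_sortedE; last exact: ltn_trans.
  case/andP => /allP /(_ _ bC) /= lt _.
  by have := ltbC x (mem_head _ _); lia.
rewrite mul1r IH //=; last 2 first.
- by rewrite addnS.
- by rewrite Qb.
rewrite sorted_pairwise; last exact: ltn_trans.
rewrite pairwise_cat /= -!sorted_pairwise; do ?exact: ltn_trans.
rewrite srts srtC andbT /=; apply/andP; split.
  apply/allrelP => x y /ltsb lt; rewrite inE => /orP[/eqP->|/ltbC lt2]; lia.
apply/allP => y yC; have := ltbC y yC; rewrite leq_eqVlt => /orP[/eqP e|//].
by move: nbC1; rewrite e yC.
Qed.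

End StripDet.

Lemma sorted_iota (C : seq nat) (m n : nat) : sorted ltn C -> size C = n ->
  all (fun j => m <= j < m + n)%N C -> C = iota m n.
Proof.
move=> srt sz /allP sub; apply: (irr_sorted_eq ltn_trans ltnn) => //.
  exact: iota_ltn_sorted.
apply: (uniq_min_size _ _ _).2.
- exact: sorted_uniq ltn_trans ltnn _ srt.
- by move=> j /sub; rewrite mem_iota.
by rewrite size_iota sz.
Qed.

(* The paths of [vrow] and [hrow] on line [t], for a wall ending before line [D]. *)
Fixpoint rowT (a D t k : nat) : int -> rat :=
  if t is t'.+1 then
    let f := ev (rowT a D t' k) in
    if odd t && (t < D)%N then cut (a%:Z - t'./2%:Z - 1) f else f
  else dlt k.

Lemma rowT_even a D e k : (e + e <= D)%N -> rowT a D (e + e) k = vrow a e k.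
Proof.
elim: e => [|e IH] // le; rewrite addSn addnS /= oddD addbb /= -IH; last by lia.
rewrite ifT; last by lia.
by rewrite addnn half_double.
Qed.

Lemma rowT_odd a D e k :
  ((e + e).+1 < D)%N -> rowT a D (e + e).+1 k = hrow a e k.
Proof.
move=> lt; rewrite /= oddD addbb lt /= rowT_even; last by lia.
by rewrite addnn half_double.
Qed.

Lemma rowT_tail a d r k : rowT a (d + d) (d + d + r) k = iter r ev (vrow a d k).
Proof.
elim: r => [|r IH]; first by rewrite addn0 rowT_even.
by rewrite addnS /= IH ifF // andbC ltnNge (leq_trans (leq_addr r _)).
Qed.

Lemma rowT_hole a D t k x : odd t -> (t < D)%N ->
  x = a%:Z - t./2%:Z - 1 -> rowT a D t k x = 0.
Proof.
case: t => //= t ot lt ->.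
by rewrite uphalf_half ot lt (negbTE ot) add0n /= /cut eqxx.
Qed.

Lemma rowT_supp a D t k x : (k < a + a)%N ->
  (a + a)%N%:Z <= x \/ x < - t%:Z -> rowT a D t k x = 0.
Proof.
move=> lt; elim: t x => [|t IH] x out.
  by rewrite /= /dlt; case: eqP => // e; case: out; lia.
have e0 : ev (rowT a D t k) x = 0 by rewrite /ev !IH ?addr0 //; case: out; lia.
by rewrite /=; case: ifP => // _; rewrite /cut e0 if_same.
Qed.

Lemma eq_ldet w (L1 L2 : seq (nat -> rat)) :
  (forall l k, (l < w)%N -> (k < w)%N ->
     nth (fun=> 0) L1 l k = nth (fun=> 0) L2 l k) -> ldet w L1 = ldet w L2.
Proof. by move=> e; congr (\det _); apply/matrixP => l k; rewrite !mxE e. Qed.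

Lemma eq_ldet_map w (f g : nat -> nat -> rat) (s : seq nat) : size s = w ->
  (forall j k, j \in s -> (k < w)%N -> f j k = g j k) ->
  ldet w (map f s) = ldet w (map g s).
Proof.
move=> sz e; apply: eq_ldet => l k lw kw.
by rewrite !(nth_map 0%N) ?sz // e // mem_nth ?sz.
Qed.

Lemma ldet_iota w m (f : nat -> nat -> rat) :
  ldet w (map f (iota m w)) = \det (\matrix_(l < w, k < w) f (m + l)%N k).
Proof.
congr (\det _); apply/matrixP => l k.
by rewrite !mxE (nth_map 0%N) ?size_iota // nth_iota.
Qed.

(** The test for the vertical edge from [j] to [j.+1] on line [t]. Within the [b + c] strips, a
    triangle is in the hexagon exactly when its vertical edge is. *)
Definition hseg (p b c t j : nat) : bool :=
  [&& c <= t + j, j < p + c & t + j < p + b + c]%N.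

Definition region (p b c d : nat) (r : bool) (i j : nat) : bool :=
  [&& (i < b + c)%N, hseg p b c (if r then i else i.+1) j
    & ~~ ((j + j + i + (if r then 1 else 2) == c + c + p) && (i < d + d))%N].

(** The left-pointing triangles of the last strip are the [p] end points on the right side; the
    bound excludes that the last bowtie takes one of them. *)
Lemma region_whole p b c d : (0 < b + c)%N ->
  (d + d + odd p <= b + c)%N ->
  mu (hexN p b c) (region p b c d)
  = mu (hexN p b c) (front (region p b c d) (b + c).-1 [::] (iota 0 p)).
Proof.
move=> n0 dn; apply: eq_mu => r i j; rewrite /front.
case: (ltngtP i (b + c).-1) => [//|lt|->] /=.
  by rewrite /region; have -> : (i < b + c)%N = false by lia.
case: r; first by rewrite andbT.
rewrite mem_iota /region /hseg; lia.
Qed.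

Lemma even_strip a b c d t s : (d + d <= b + c)%N -> (t < b + c)%N ->
  let Q := region (a + a) b c d in
  (forall C, sorted ltn C -> size C = (a + a)%N -> all (Q true t) C ->
    (mu (hexN (a + a) b c) (front Q t C [::]))%:R
    = ldet (a + a) [seq (fun k => rowT a (d + d) t k (j%:Z - c%:Z)) | j <- C]) ->
  sorted ltn s -> size s = (a + a)%N -> all (Q false t) s ->
  (mu (hexN (a + a) b c) (front Q t [::] s))%:R
  = ldet (a + a) [seq (fun k => rowT a (d + d) t.+1 k (j%:Z - c%:Z)) | j <- s].
Proof.
move=> dn tn Q detC srt sz /allP Qs.
have detC1 C : sorted ltn C -> size C = (a + a)%N -> all (Q true t) C ->
    (mu (hexN (a + a) b c) (front Q t C [::]))%:R
    = 1 * ldet (a + a) [seq (fun k => rowT a (d + d) t k (j%:Z - c%:Z)) | j <- C].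
  by rewrite mul1r; apply: detC.
rewrite (front_det_mixed _ detC1) ?cats0 ?addn0 //.
- rewrite mul1r; apply: eq_ldet_map => // j k /Qs; rewrite /Q /region /hseg => Qj _.
  rewrite /=; case: ifP => // /andP[ot lt]; rewrite /cut ifF //.
  by apply/eqP => e; move: ot => /= ot; lia.
- by rewrite /hexN; lia.
- by apply/allP => j /Qs; rewrite /Q /region /hseg /hexN; lia.
move=> x j /Qs; rewrite /Q /region /hseg => Qx ej nQ k lt.
(* A missing triangle is either half of a deleted lozenge, where the row was cut, or outside the
   hexagon, where the row has no support. *)
have [hole|nhole] := boolP (odd t && (t < d + d)%N
  && (j + j + t + 1 == c + c + (a + a))%N).
  by apply: rowT_hole; lia.
by apply: rowT_supp => //; lia.
Qed.

Lemma even_front a b c d t s : (d + d <= b + c)%N -> (t < b + c)%N ->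
  let Q := region (a + a) b c d in
  sorted ltn s -> size s = (a + a)%N -> all (Q false t) s ->
  (mu (hexN (a + a) b c) (front Q t [::] s))%:R
  = ldet (a + a) [seq (fun k => rowT a (d + d) t.+1 k (j%:Z - c%:Z)) | j <- s].
Proof.
move=> dn + Q; elim: t s => [|t IH] s tn srt sz QS.
  have detC C : sorted ltn C -> size C = (a + a)%N -> all (Q true 0%N) C ->
      (mu (hexN (a + a) b c) (front Q 0 C [::]))%:R
      = ldet (a + a)
              [seq (fun k => rowT a (d + d) 0 k (j%:Z - c%:Z)) | j <- C].
    move=> srtC szC QC; have defC : C = iota c (a + a).
      apply: sorted_iota => //; apply: sub_all QC => j.
      by rewrite /Q /region /hseg; lia.
    rewrite defC mu0 => [|r i j].
      rewrite ldet_iota -(det1 _ (a + a)); congr (\det _).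
      apply/matrixP => l k; rewrite !mxE /= /dlt -val_eqE /=; congr (_%:R).
      by apply/eqP/eqP; lia.
    rewrite /front; case: eqP => //= ->; case: r => //=.
    by rewrite mem_iota /Q /region /hseg; lia.
  exact: even_strip.
apply: even_strip => // C srtC szC QC.
rewrite front_nil_same //; last 2 first.
- by move=> j; rewrite /Q /region /hseg /hexN; lia.
- by move=> j; rewrite /Q /region /hseg; lia.
- apply: IH => //; first by lia.
  by apply: sub_all QC => j; rewrite /Q /region /hseg; lia.
by rewrite /hexN; lia.
Qed.

Lemma mu_even a b c d :
  (mu (hexN (a + a) (d + b) (d + c)) (region (a + a) (d + b) (d + c) d))%:R
  = evenval a d b c.
Proof.
have [n0|n0] := posnP (d + b + (d + c)).
  have -> : d = 0%N by lia.
  have -> : b = 0%N by lia.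
  have -> : c = 0%N by lia.
  rewrite evenval_mac mac0l -[RHS]/(1%:R); congr (_%:R); apply: mu0 => r i j.
  by rewrite /region; have -> : (i < 0 + 0 + (0 + 0))%N = false by lia.
rewrite region_whole //; last by rewrite oddD addbb; lia.
rewrite even_front ?iota_ltn_sorted ?size_iota //; last 3 first.
- by lia.
- by lia.
- by apply/allP => j; rewrite mem_iota /region /hseg; lia.
rewrite prednK // ldet_iota -pdet_evenval; congr (\det _).
apply/matrixP => l k; rewrite !mxE.
have -> : (d + b + (d + c) = d + d + (b + c))%N by lia.
by rewrite rowT_tail; congr (iter _ _ _ _); lia.
Qed.

(** * Regions with odd left side *)

Lemma ldet_brow_notin a d o (C : seq nat) : size C = (a + a).+1 ->
  (forall j, j \in C -> j%:Z - o != a%:Z - d%:Z - 1) ->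
  ldet (a + a).+1 [seq (fun k => brow a d k (j%:Z - o)) | j <- C] = 0.
Proof.
move=> sz nC; rewrite /ldet (expand_det_col _ ord_max) big1 // => l _.
rewrite mxE (nth_map 0%N) ?sz // /brow ltnn /dlt.
by rewrite (negbTE (nC _ _)) ?mul0r // mem_nth ?sz.
Qed.

(* If the tip is not in the middle of the end points, both sides vanish because
too many end points lie on one side of the wall. *)
Lemma ldet_brow_in a d o (C1 C2 : seq nat) (j0 : nat) :
  sorted ltn (C1 ++ j0 :: C2) -> size (C1 ++ C2) = (a + a)%N ->
  j0%:Z - o = a%:Z - d%:Z - 1 ->
  (-1) ^+ a * ldet (a + a).+1
     [seq (fun k => brow a d k (j%:Z - o)) | j <- C1 ++ j0 :: C2]
  = ldet (a + a) [seq (fun k => hrow a d k (j%:Z - o)) | j <- C1 ++ C2].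
Proof.
rewrite sorted_pairwise; last exact: ltn_trans.
rewrite pairwise_cat /= => /and3P[/allrelP ltC1 _ /andP[/allP ltC2 _]] sz ej0.
have szC1 : (size C1 < (a + a).+1)%N by move: sz; rewrite size_cat; lia.
have szC : size (C1 ++ j0 :: C2) = (a + a).+1 by move: sz; rewrite !size_cat /=; lia.
have uC l : (l < size C1)%N -> (nth 0%N C1 l < j0)%N.
  by move=> lt; apply: ltC1; rewrite ?mem_nth ?mem_head.
have uC2 l : (l < size C2)%N -> (j0 < nth 0%N C2 l)%N.
  by move=> lt; apply: ltC2; rewrite mem_nth.
set R := RHS.
have -> : ldet (a + a).+1
     [seq (fun k => brow a d k (j%:Z - o)) | j <- C1 ++ j0 :: C2]
   = (-1) ^+ size C1 * R.
  rewrite /ldet (expand_det_col _ ord_max) (bigD1 (Ordinal szC1)) //= big1 ?addr0.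
    rewrite mxE (nth_map 0%N) ?szC //= nth_cat ltnn subnn /= /brow ltnn /dlt.
    rewrite ej0 eqxx mul1r /cofactor; congr (_ * _).
      by rewrite -signr_odd oddD oddD addbb addbF signr_odd.
    congr (\det _); apply/matrixP => l k; rewrite !mxE /= /brow.
    have -> : bump (a + a) k = k by rewrite /bump leqNgt ltn_ord.
    rewrite (nth_map 0%N) ?szC ?ltn_ord; last first.
      by rewrite /bump; have /= := ltn_ord l; case: leqP => /=; lia.
    rewrite (nth_map 0%N) ?sz ?ltn_ord //; congr (hrow _ _ _ (_%:Z - _)).
    rewrite !nth_cat /bump; case: (leqP (size C1) l) => le /=.
      by rewrite add1n ltnNge (leqW le) /= subSn.
    by rewrite add0n le.
  move=> l nel; rewrite mxE (nth_map 0%N) ?szC //= /brow ltnn /dlt.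
  case: eqP => [e|_]; last by rewrite mul0r.
  have {}e : nth 0%N (C1 ++ j0 :: C2) l = j0 by lia.
  move: e; rewrite nth_cat; case: ltnP => [lt|ge].
    by move=> e; have := uC _ lt; rewrite e ltnn.
  case el : (l - size C1)%N => [|m] /= e.
    by case/eqP: nel; apply: val_inj => /=; lia.
  have lt : (m < size C2)%N by have := ltn_ord l; move: sz; rewrite size_cat; lia.
  by have := uC2 _ lt; rewrite e ltnn.
rewrite mulrA -exprD; have [->|/eqP ne] := eqVneq (size C1) a.
  by rewrite addnn -mul2n exprM sqrrN !expr1n mul1r.
have -> : R = 0; last by rewrite mulr0.
have [lt|ge] := ltnP a (size C1).
  apply: (@det_zero_block _ _ [set l : 'I_(a + a) | (l < size C1)%N]
                              (~: [set k : 'I_(a + a) | (k < a)%N])).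
    move=> l k; rewrite !inE -leqNgt => ltl lek; rewrite mxE (nth_map 0%N) ?sz //.
    rewrite nth_cat ltl -(subnKC lek) hrow_top ifF //.
    by have := uC _ ltl; lia.
  rewrite card_ord_ge ?card_ord_lt; lia.
apply: (@det_zero_block _ _ (~: [set l : 'I_(a + a) | (l < size C1)%N])
                            [set k : 'I_(a + a) | (k < a)%N]).
  move=> l k; rewrite !inE -leqNgt => lel ltk; rewrite mxE (nth_map 0%N) ?sz //.
  rewrite nth_cat ltnNge lel /=.
  have -> : nat_of_ord k = (a - (a - k.+1).+1)%N by lia.
  rewrite hrow_bot ?ifF //; last by lia.
  have lt2 : (l - size C1 < size C2)%N.
    by have := ltn_ord l; move: sz; rewrite size_cat; lia.
  by have := uC2 _ lt2; lia.
rewrite card_ord_ge ?card_ord_lt; lia.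
Qed.

Lemma ldet_brow a d o (C : seq nat) (j0 : nat) : sorted ltn C ->
  size C = (a + a).+1 -> j0 \in C -> j0%:Z - o = a%:Z - d%:Z - 1 ->
  (-1) ^+ a * ldet (a + a).+1 [seq (fun k => brow a d k (j%:Z - o)) | j <- C]
  = ldet (a + a)
      [seq (fun k => hrow a d k (j%:Z - o)) | j <- [seq j <- C | j != j0]].
Proof.
move=> srt sz j0C ej0; have uC := sorted_uniq ltn_trans ltnn srt.
case/splitPr: j0C srt sz uC => C1 C2 srt sz uC.
have -> : [seq j <- C1 ++ j0 :: C2 | j != j0] = C1 ++ C2.
  move: uC; rewrite cat_uniq /= negb_or => /and3P[_ /andP[n1 _] /andP[n2 _]].
  rewrite filter_cat /= eqxx; congr (_ ++ _); apply/all_filterP/allP => x xC.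
    by apply: contraNneq n1 => <-.
  by apply: contraNneq n2 => <-.
by apply: ldet_brow_in => //; move: sz; rewrite !size_cat /=; lia.
Qed.

Lemma ldet_brow_iota a d m :
  ldet (a + a).+1 [seq (fun k => brow a d k (j%:Z - (m + d).+1%:Z))
                  | j <- iota m (a + a).+1]
  = (-1) ^+ a * symp a 1 d ^+ 2.
Proof.
rewrite -oddval_base -pdet_odd_base ldet_iota; congr (\det _).
by apply/matrixP => l k; rewrite !mxE /=; congr (brow _ _ _ _); lia.
Qed.

Lemma signr_sqr a : (-1) ^+ a * (-1) ^+ a = 1 :> rat.
Proof. by rewrite -exprD addnn -mul2n exprM sqrrN !expr1n. Qed.

Lemma size_filter_neq (C : seq nat) j0 : uniq C -> j0 \in C ->
  size [seq j <- C | j != j0] = (size C).-1.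
Proof. by move=> uC j0C; rewrite -(size_rem j0C) rem_filter. Qed.

(* The hexagon with [p = 2a + 1] is read one line later than the one with
[p = 2a], whence [t.+1] and the offset [c.+1]. *)
Lemma odd_strip_pre a b c d t s : (t < d + d)%N -> (t < b + c)%N ->
  let Q := region (a + a).+1 b c d in
  (forall C, sorted ltn C -> size C = (a + a)%N -> all (Q true t) C ->
    (mu (hexN (a + a).+1 b c) (front Q t C [::]))%:R
    = ldet (a + a)
        [seq (fun k => rowT a (d + d).+2 t.+1 k (j%:Z - c.+1%:Z)) | j <- C]) ->
  sorted ltn s -> size s = (a + a)%N -> all (Q false t) s ->
  (mu (hexN (a + a).+1 b c) (front Q t [::] s))%:R
  = ldet (a + a)
      [seq (fun k => rowT a (d + d).+2 t.+2 k (j%:Z - c.+1%:Z)) | j <- s].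
Proof.
move=> td tn Q detC srt sz /allP Qs.
have detC1 C : sorted ltn C -> size C = (a + a)%N -> all (Q true t) C ->
    (mu (hexN (a + a).+1 b c) (front Q t C [::]))%:R
    = 1 * ldet (a + a)
        [seq (fun k => rowT a (d + d).+2 t.+1 k (j%:Z - c.+1%:Z)) | j <- C].
  by rewrite mul1r; apply: detC.
rewrite (front_det_mixed _ detC1) ?cats0 ?addn0 //.
- rewrite mul1r; apply: eq_ldet_map => // j k /Qs; rewrite /Q /region /hseg => Qj _.
  rewrite -[RHS]/((if odd t.+2 && (t.+2 < (d + d).+2)%N
    then cut (a%:Z - t.+1./2%:Z - 1) (ev (rowT a (d + d).+2 t.+1 k))
    else ev (rowT a (d + d).+2 t.+1 k)) (j%:Z - c.+1%:Z)).
  case: ifP => // /andP[ot lt]; rewrite /cut ifF //.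
  by apply/eqP => e; move: ot => /= ot; lia.
- by rewrite /hexN; lia.
- by apply/allP => j /Qs; rewrite /Q /region /hseg /hexN; lia.
move=> x j /Qs; rewrite /Q /region /hseg => Qx ej nQ k lt.
have [hole|nhole] := boolP (~~ odd t && (j + j + t + 1 == c + c + (a + a).+1)%N).
  apply: rowT_hole => /=; [lia|lia|].
  by move: hole => /andP[]; lia.
by apply: rowT_supp => //; lia.
Qed.

Lemma odd_front_pre a b c d t s : (t < d + d)%N -> (t < b + c)%N ->
  let Q := region (a + a).+1 b c d in
  sorted ltn s -> size s = (a + a)%N -> all (Q false t) s ->
  (mu (hexN (a + a).+1 b c) (front Q t [::] s))%:R
  = ldet (a + a)
      [seq (fun k => rowT a (d + d).+2 t.+2 k (j%:Z - c.+1%:Z)) | j <- s].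
Proof.
move=> + + Q; elim: t s => [|t IH] s td tn srt sz QS.
  apply: odd_strip_pre => // C srtC szC QC.
  (* The first bowtie removes the middle triangle, at [c + a], along the left side. *)
  have defC : C = [seq j <- iota c (a + a).+1 | j != (c + a)%N].
    apply: (irr_sorted_eq ltn_trans ltnn) => //.
      exact/sorted_filter/iota_ltn_sorted/ltn_trans.
    apply: (uniq_min_size _ _ _).2.
    - exact: sorted_uniq ltn_trans ltnn _ srtC.
    - move=> j /(allP QC); rewrite mem_filter mem_iota /Q /region /hseg; lia.
    by rewrite szC size_filter_neq ?iota_uniq ?size_iota // mem_iota; lia.
  transitivity (1 : rat).
    rewrite -[RHS]/(1%:R); congr (_%:R); apply: mu0 => r i j; rewrite /front.
    case: eqP => //= ->; case: r => //=.
    by rewrite defC mem_filter mem_iota /Q /region /hseg; lia.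
  (* Read one line later, these positions are [2a] paths after a forced first step around the wall;
     the determinant is 1 because [symp a 1 0 = 1]. *)
  rewrite (@eq_ldet_map _ _ (fun j k => hrow a 0 k (j%:Z - c.+1%:Z))) //.
  rewrite defC -ldet_brow ?iota_ltn_sorted ?size_iota //.
  - have := ldet_brow_iota a 0 c; rewrite addn0 => ->.
    by rewrite symp0 expr1n mulr1 signr_sqr.
  - by rewrite mem_iota; lia.
  by lia.
apply: odd_strip_pre => // C srtC szC QC.
rewrite front_nil_same //; last 2 first.
- by move=> j; rewrite /Q /region /hseg /hexN; lia.
- by move=> j; rewrite /Q /region /hseg; lia.
- apply: IH => //; [by lia|by lia|].
  by apply: sub_all QC => j; rewrite /Q /region /hseg; lia.
by rewrite /hexN; lia.
Qed.

Lemma iter_ev_supp r f (u v : int) : (forall x, u <= x \/ x < v -> f x = 0) ->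
  forall x, u <= x \/ x < v - r%:Z -> iter r ev f x = 0.
Proof.
move=> f0; elim: r => [|r IH] x out; first by apply: f0; case: out; lia.
by rewrite /= /ev !IH ?addr0 //; case: out; lia.
Qed.

(** On line [d + d] the path from the tip joins. For [d = 0] the tip is the middle edge of the left
    side, and all starting points are consecutive. *)
Lemma odd_tip a b c d C : (d + d < b + c)%N -> (d <= b)%N -> (d <= c)%N ->
  let Q := region (a + a).+1 b c d in
  sorted ltn C -> size C = (a + a).+1 -> all (Q true (d + d)%N) C ->
  (mu (hexN (a + a).+1 b c) (front Q (d + d) C [::]))%:R
  = (-1) ^+ a
    * ldet (a + a).+1 [seq (fun k => brow a d k (j%:Z - c.+1%:Z)) | j <- C].
Proof.
move=> dn db dc Q srtC szC QC; case: (posnP d) => [d0|d0].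
  subst d.
  have defC : C = iota c (a + a).+1.
    apply: sorted_iota => //; apply: sub_all QC => j.
    by rewrite /Q /region /hseg; lia.
  rewrite defC; have := ldet_brow_iota a 0 c; rewrite addn0 => ->.
  rewrite symp0 expr1n mulr1 signr_sqr.
  rewrite -[RHS]/(1%:R); congr (_%:R); apply: mu0 => r i j; rewrite /front.
  rewrite ltn0; case: eqP => // ->; case: r => //.
  by rewrite mem_iota /Q /region /hseg; lia.
pose j0 := (c + a - d)%N.
have ej0 : j0%:Z - c.+1%:Z = a%:Z - d%:Z - 1 by rewrite /j0; lia.
have [t et] : exists t, (d + d = t.+1)%N by exists (d + d).-1; lia.
rewrite et (@front_nil_tip _ _ _ _ j0); last 1 first.
- by rewrite -et.
- case: (boolP (j0 \in C)) => [j0C|nj0C] /=; last first.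
    rewrite mul0n ldet_brow_notin ?mulr0 // => j jC.
    apply: contraNneq nj0C => e; have -> : j0 = j by lia.
    exact: jC.
  rewrite mul1n (ldet_brow srtC szC j0C ej0) odd_front_pre; last 1 first.
  + apply/allP => j; rewrite mem_filter => /andP[ne /(allP QC)].
    by rewrite /Q /region /hseg /j0 in ne *; lia.
  + apply: eq_ldet_map => [|j k _ lt]; last by rewrite -et rowT_odd.
    by rewrite size_filter_neq ?szC // (sorted_uniq ltn_trans ltnn srtC).
  + by lia.
  + by lia.
  + by apply: sorted_filter => //; apply: ltn_trans.
  by rewrite size_filter_neq ?szC // (sorted_uniq ltn_trans ltnn srtC).
- by rewrite /hexN; lia.
- by move=> j; rewrite /Q /region /hseg /hexN; lia.
- by move=> j; rewrite /Q /region /hseg /j0; lia.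
by rewrite /Q /region /hseg /j0; lia.
Qed.

Lemma odd_strip_post a b c d r s : (d + d + r < b + c)%N ->
  (d <= b)%N -> (d <= c)%N ->
  let Q := region (a + a).+1 b c d in
  (forall C, sorted ltn C -> size C = (a + a).+1 ->
    all (Q true (d + d + r)%N) C ->
    (mu (hexN (a + a).+1 b c) (front Q (d + d + r) C [::]))%:R
    = (-1) ^+ a * ldet (a + a).+1
        [seq (fun k => iter r ev (brow a d k) (j%:Z - c.+1%:Z)) | j <- C]) ->
  sorted ltn s -> size s = (a + a).+1 -> all (Q false (d + d + r)%N) s ->
  (mu (hexN (a + a).+1 b c) (front Q (d + d + r) [::] s))%:R
  = (-1) ^+ a * ldet (a + a).+1
      [seq (fun k => iter r.+1 ev (brow a d k) (j%:Z - c.+1%:Z)) | j <- s].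
Proof.
move=> rn db dc Q detC srt sz /allP Qs.
rewrite (@front_det_mixed _ _ _ _ (fun k => iter r ev (brow a d k)) c.+1%:Z
           _ _ detC) ?cats0 ?addn0 //.
- by rewrite /hexN; lia.
- by apply/allP => j /Qs; rewrite /Q /region /hseg /hexN; lia.
move=> x j /Qs; rewrite /Q /region /hseg => Qx ej nQ k lt.
apply: (@iter_ev_supp _ _ (a + a)%N%:Z (- (d + d).+1%:Z)); last by lia.
move=> y out; rewrite /brow; case: ifP => [ltk|_].
  by rewrite -(@rowT_odd _ (d + d).+2) //; apply: rowT_supp.
by rewrite /dlt; case: eqP => // e; case: out; lia.
Qed.

Lemma odd_front_post a b c d r s : (d + d + r < b + c)%N ->
  (d <= b)%N -> (d <= c)%N ->
  let Q := region (a + a).+1 b c d in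
  sorted ltn s -> size s = (a + a).+1 -> all (Q false (d + d + r)%N) s ->
  (mu (hexN (a + a).+1 b c) (front Q (d + d + r) [::] s))%:R
  = (-1) ^+ a * ldet (a + a).+1
      [seq (fun k => iter r.+1 ev (brow a d k) (j%:Z - c.+1%:Z)) | j <- s].
Proof.
move=> + db dc Q; elim: r s => [|r IH] s rn srt sz Qs.
  apply: odd_strip_post => // C srtC szC QC.
  by rewrite addn0 in QC rn *; apply: odd_tip.
apply: odd_strip_post => // C srtC szC QC; rewrite addnS in QC rn *.
rewrite front_nil_same //; last 2 first.
- by move=> j; rewrite /Q /region /hseg /hexN; lia.
- by move=> j; rewrite /Q /region /hseg; lia.
- apply: IH => //; first by lia.
  by apply: sub_all QC => j; rewrite /Q /region /hseg; lia.
by rewrite /hexN; lia.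
Qed.

Lemma mu_odd a b c d :
  (mu (hexN (a + a).+1 (d + b) (d + c)) (region (a + a).+1 (d + b) (d + c) d))%:R
  = oddval a d b c.
Proof.
have [n0|n0] := posnP (b + c).
  have -> : b = 0%N by lia.
  have -> : c = 0%N by lia.
  rewrite oddval_base !addn0; case: (posnP d) => [->|d0].
    rewrite symp0 expr1n -[RHS]/(1%:R); congr (_%:R); apply: mu0 => r i j.
    by rewrite /region; have -> : (i < 0 + 0)%N = false by lia.
  (* The wall reaches the right side and its last bowtie takes the middle end point [a], so no path
     starts at a tip. *)
  rewrite (@eq_mu _ _ (front (region (a + a).+1 d d d) (d + d).-1 [::]
              [seq j <- iota 0 (a + a).+1 | j != a])).
    rewrite odd_front_pre; last 1 first.
    - by apply/allP => j; rewrite mem_filter mem_iota /region /hseg; lia.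
    - rewrite (@eq_ldet_map _ _ (fun j k => hrow a d k (j%:Z - d.+1%:Z))).
      + rewrite -ldet_brow ?iota_ltn_sorted ?size_iota ?mem_iota //; try lia.
        have := ldet_brow_iota a d 0; rewrite add0n => ->.
        by rewrite mulrA (signr_sqr a) mul1r.
      + by rewrite size_filter_neq ?iota_uniq ?size_iota // mem_iota; lia.
      by move=> j k _ _; rewrite prednK ?rowT_odd //; lia.
    - by lia.
    - by lia.
    - exact/sorted_filter/iota_ltn_sorted/ltn_trans.
    by rewrite size_filter_neq ?iota_uniq ?size_iota // mem_iota; lia.
  move=> r i j; rewrite /front; case: (ltngtP i (d + d).-1) => [//|lt|->].
    by rewrite andFb /region; have -> : (i < d + d)%N = false by lia.
  rewrite andTb; case: r; first by rewrite andbT.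
  by rewrite mem_filter mem_iota /region /hseg; lia.
rewrite region_whole; [|lia|rewrite /= oddD addbb; lia].
have -> : (d + b + (d + c)).-1 = (d + d + (b + c).-1)%N by lia.
rewrite odd_front_post ?iota_ltn_sorted ?size_iota //; last 4 first.
- by lia.
- by lia.
- by lia.
- by apply/allP => j; rewrite mem_iota /region /hseg; lia.
have -> : oddval a d b c = (-1) ^+ a * ((-1) ^+ a * oddval a d b c).
  by rewrite mulrA signr_sqr mul1r.
rewrite prednK // ldet_iota -pdet_oddval; congr (_ * _); congr (\det _).
apply/matrixP => l k; rewrite !mxE.
by congr (iter _ _ _ _); lia.
Qed.

Local Open Scope nat_scope.

(** * From the hexagon with labelled triangles to coordinates *)

Lemma mem_Hex p b c (t : tri (hexN p b c)) :
  (t \in Hex p b c)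
  = (t.1.2 < b + c) && hseg p b c (if t.1.1 then t.1.2 : nat else t.1.2.+1) t.2.
Proof.
rewrite inE; case: t => [[[] i] j] /=; rewrite /in_hex /hseg /=; lia.
Qed.

(** The doubled heights of a triangle span an interval of length 2, whose only interior integer is
    the height of the middle vertex. *)
Lemma meets_lE p c N (t : tri N) :
  meets_l p c t = (t.2 + t.2 + t.1.2 + (if t.1.1 then 1 else 2) == c + c + p).
Proof. by case: t => [[[] i] j]; rewrite /meets_l /= /height2 /=; lia. Qed.

(** Every strip to the left contains exactly one triangle of the hexagon on the axis, so labels
    count strips. *)
Lemma lab_axis p b c (t : tri (hexN p b c)) :
  t \in Hex p b c -> meets_l p c t -> lab t = (tri_col t).+1.
Proof.
move=> tH tl; rewrite /lab; congr _.+1.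
set S := [set _ in _ | _].
have injS : {in S &, injective (fun u : tri (hexN p b c) => u.1.2)}.
  move=> [[r1 i1] j1] [[r2 i2] j2]; rewrite !inE.
  move=> /and3P[_ m1 _] /and3P[_ m2 _] /= ei.
  move: m1 m2; rewrite -ei !meets_lE /=.
  case: r1 r2 => [] [] m1 m2; try lia.
    by congr (_, _, _); apply: val_inj => /=; lia.
  by congr (_, _, _); apply: val_inj => /=; lia.
rewrite -(card_in_imset injS).
rewrite -[RHS](@card_ord_lt (hexN p b c)); last exact: ltnW (ltn_ord _).
apply: eq_card => k; rewrite [in RHS]inE.
apply/imsetP/idP => [[u]|lt_k].
  by rewrite !inE => /and3P[_ _ lt] ->.
(* The parity of [p + k] decides which orientation meets the axis in strip [k]. *)
pose r := odd (p + k).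
pose j' := (c + c + p - k - (if r then 1 else 2))./2.
have ltj : j' < hexN p b c by rewrite /j' /hexN; case: (r); lia.
move: tH tl; rewrite mem_Hex meets_lE /tri_col in lt_k * => tH tl.
have ej : j' + j' + k + (if r then 1 else 2) = c + c + p.
  move: tH tl; rewrite /j' /r /hseg.
  by case: (boolP (odd _)) => o; case: (t.1.1); lia.
exists ((r, k, Ordinal ltj) : tri (hexN p b c)) => //.
rewrite inE mem_Hex meets_lE /tri_col /= lt_k ej eqxx !andbT.
move: tH tl ej; rewrite /hseg; case: (r); case: (t.1.1); lia.
Qed.

Lemma M_HexD p b c d :
  M (HexD p b c d) = mu (hexN p b c) (region p b c d).
Proof.
congr (M _); apply/setP => t; rewrite [RHS]in_set /HexD in_setD.
have -> : (t \in [set u in Hex p b c | meets_l p c u && (lab u <= 2 * d)])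
    = (t \in Hex p b c) && (meets_l p c t && (lab t <= 2 * d)) by rewrite in_set.
transitivity ((t \in Hex p b c) && ~~ (meets_l p c t && (t.1.2 < d + d))); last first.
  by rewrite mem_Hex meets_lE /region andbA.
case: (boolP (t \in Hex p b c)) => tH; last by rewrite andbF.
case: (boolP (meets_l p c t)) => //= tl.
by rewrite lab_axis // mul2n -addnn andbT.
Qed.

Lemma M_Hex p b c : M (Hex p b c) = mu (hexN p b c) (region p b c 0).
Proof.
rewrite -M_HexD; congr (M _); apply/setP => t; rewrite !inE.
by case: (all _ _) => //=; rewrite andbF.
Qed.

Local Open Scope ring_scope.

(** * Shifted factorials *)

(** Both sides are [Gamma(x + n + 1) / Gamma(x)]. *)
Lemma poch_shift x (n : int) : 0 < x + n%:~R ->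
  poch (x + 1) n * x = poch x n * (x + n%:~R).
Proof.
case: n => m; rewrite /poch => lt.
  rewrite -pmulrn; elim: m {lt} => [|m IH]; first by rewrite !big_ord0 addr0.
  rewrite big_ord_recr [in RHS]big_ord_recr /= mulrAC IH -!natr1; ring.
rewrite NegzE mulrNz -pmulrn in lt *.
have pos (i : nat) : (i <= m.+1)%N -> 0 < x - i%:R.
  by move=> le; have : i%:R <= m.+1%:R :> rat; [rewrite ler_nat|lra].
have n0 (i : nat) : (i <= m.+1)%N -> x - i%:R != 0.
  by move=> le; rewrite gt_eqF // pos.
have p1 : \prod_(i < m.+1) (x + 1 - i.+1%:R) != 0.
  apply/prodf_neq0 => i _; have := n0 i (ltnW (ltn_ord i)).
  by rewrite -natr1; apply: contraNneq => e; apply/eqP; lra.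
have p2 : \prod_(i < m.+1) (x - i.+1%:R) != 0.
  by apply/prodf_neq0 => i _; apply: n0; apply: ltn_ord.
apply: (mulIf p1); rewrite mulrAC mulVf // mul1r.
apply: (mulfI p2); rewrite !mulrA mulfV // mul1r.
rewrite [\prod_(i < m.+1) (x + 1 - i.+1%:R)]big_ord_recl big_ord_recr /=.
have -> : \prod_(i < m) (x + 1 - (bump 0 i).+1%:R) = \prod_(i < m) (x - i.+1%:R).
  by apply: eq_bigr => i _; rewrite /bump /= add1n -natr1; ring.
ring.
Qed.

Lemma poch_recr x (n : int) : 0 < x + n%:~R ->
  poch x (n + 1) = poch x n * (x + n%:~R).
Proof.
case: n => [m|[|m]] lt.
- by rewrite -PoszD addn1 /poch big_ord_recr -pmulrn.
- rewrite -[Negz 0 + 1]/(Posz 0) /poch big_ord0 big_ord1 mulVf //.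
  by move: lt; rewrite NegzE mulrNz => /lt0r_neq0.
have -> : Negz m.+1 + 1 = Negz m by lia.
rewrite /poch [in RHS]big_ord_recr /= NegzE mulrNz -pmulrn invfM -mulrA.
rewrite mulVf ?mulr1 //.
by move: lt; rewrite NegzE mulrNz -pmulrn => /lt0r_neq0.
Qed.

Lemma poch_neq0 x (n : int) : 0 < x -> 0 < x + n%:~R -> poch x n != 0.
Proof.
move=> x0; case: n => m; rewrite /poch => lt.
  apply/prodf_neq0 => i _; apply: lt0r_neq0.
  by have := ler0n rat i; lra.
rewrite invr_eq0; apply/prodf_neq0 => i _; apply: lt0r_neq0.
rewrite NegzE mulrNz -pmulrn in lt.
by have : i.+1%:R <= m.+1%:R :> rat; [rewrite ler_nat|lra].
Qed.

Lemma poch_shiftE x y (n : int) : y = x + 1 -> 0 < x -> 0 < x + n%:~R ->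
  poch y n = poch x n * ((x + n%:~R) / x).
Proof.
move=> -> x0 lt; rewrite mulrA -poch_shift // mulfK //.
exact: lt0r_neq0.
Qed.

Definition eventerm (a b c k : nat) (f : int) : rat :=
  poch (k%:R + 1/2) (b%:Z - (2 * k)%:Z)
  * poch (a%:R + k%:R + 1) (b%:Z - (2 * k)%:Z - 1)
  * poch (b%:R - k%:R + 1/2) f
  * poch (c%:R - k%:R) (- f)
  / (poch (a%:R + k%:R + 1/2) (b%:Z - (2 * k)%:Z)
     * poch (k%:R + 1) (b%:Z - (2 * k)%:Z - 1)
     * poch (a%:R + b%:R - k%:R + 1/2) f
     * poch (a%:R + c%:R - k%:R) (- f)).

Definition oddterm (a b c k : nat) (f : int) : rat :=
  poch (a%:R + k%:R + 1) (c%:Z - (2 * k)%:Z)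
  * poch (k%:R + 3/2) (c%:Z - (2 * k)%:Z - 2)
  * poch (b%:R - k%:R) f
  * poch (c%:R - k%:R - 1/2) (- f)
  / (poch (k%:R + 1) (c%:Z - (2 * k)%:Z - 1)
     * poch (a%:R + k%:R + 3/2) (c%:Z - (2 * k)%:Z - 1)
     * poch (a%:R + b%:R - k%:R + 1) f
     * poch (a%:R + c%:R - k%:R + 1/2) (- f)).

Lemma intr_sub2 (b k : nat) : (b%:Z - (2 * k)%:Z)%:~R = b%:R - 2 * k%:R :> rat.
Proof. by rewrite intrB -!pmulrn natrM. Qed.

(** As [b] and [c] are counted from the end of the wall, this change of indices lengthens the wall
    inside a fixed hexagon. *)
Lemma afac_ratio j d b c :
  afac j d.+1 b c
  = afac j d b.+1 c.+1 * ((d + d + j + j).+2%:R * (d + d + j + j).+1%:R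
      * (b + j).+1%:R * (c + j).+1%:R
      / ((d + j).+1%:R ^+ 2 * (b + c + j + j).+2%:R * (b + c + j + j).+3%:R)).
Proof. by rewrite /afac; facmono. Qed.

Lemma bfac_ratio j d b c :
  bfac j d.+1 b c
  = bfac j d b.+1 c.+1 * ((d + d + j + j).+4%:R * (d + d + j + j).+3%:R
      * (b + j).+2%:R * (c + j).+2%:R
      / ((d + j).+2%:R * (d + j).+1%:R
         * (b + c + j + j).+3%:R * (b + c + j + j).+4%:R)).
Proof. by rewrite /bfac; facmono. Qed.

(** Induction on [a]: both ratios are 1 at [a = 0], and a step shifts four arguments by 1. The bit
    [e] is the parity of [c - b]; the floor [f] is such that [(a+b+f+3/2)(a+c-f+1) =
    (2a+b+c+2)(2a+b+c+3)/4] for either parity. *)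
Lemma evenval_term a d b f (e : bool) :
  let c := (b + f + f + e)%N in
  evenval a d.+1 b c
  = evenval a d b.+1 c.+1 * eventerm a (d.+1 + b) (d.+1 + c) d f%:Z.
Proof.
move=> c.
have d0 := ler0n rat d; have b0 := ler0n rat b; have f0 := ler0n rat f.
have cE : c%:R = b%:R + f%:R + f%:R + (e : nat)%:R :> rat by rewrite !natrD.
have e0 := ler0n rat e.
have dbE : (d.+1 + b)%:R = d%:R + 1 + b%:R :> rat by rewrite natrD -natr1.
have dcE : (d.+1 + c)%:R = d%:R + 1 + c%:R :> rat by rewrite natrD -natr1.
have nE : ((d.+1 + b)%:Z - (2 * d)%:Z)%:~R = 1 + b%:R - d%:R :> rat.
  by rewrite intr_sub2 dbE; ring.
have nE1 : ((d.+1 + b)%:Z - (2 * d)%:Z - 1)%:~R = b%:R - d%:R :> rat.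
  by rewrite intrB nE; ring.
have fE : (- f%:Z)%:~R = - f%:R :> rat by rewrite mulrNz -pmulrn.
have fE1 : (f%:Z)%:~R = f%:R :> rat by rewrite -pmulrn.
elim: a => [|a IH].
  rewrite /evenval !big_ord0 mul1r /eventerm !add0r divff //.
  rewrite !mulf_neq0 ?poch_neq0 ?nE ?nE1 ?fE ?fE1 ?dbE ?dcE ?cE //; lra.
have a0 := ler0n rat a.
have s1 := @poch_shiftE (a%:R + d%:R + 1) (a.+1%:R + d%:R + 1)
  ((d.+1 + b)%:Z - (2 * d)%:Z - 1).
have s2 := @poch_shiftE (a%:R + d%:R + 1/2) (a.+1%:R + d%:R + 1/2)
  ((d.+1 + b)%:Z - (2 * d)%:Z).
have s3 := @poch_shiftE (a%:R + (d.+1 + b)%:R - d%:R + 1/2)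
  (a.+1%:R + (d.+1 + b)%:R - d%:R + 1/2) f.
have s4 := @poch_shiftE (a%:R + (d.+1 + c)%:R - d%:R)
  (a.+1%:R + (d.+1 + c)%:R - d%:R) (- f%:Z).
rewrite nE1 in s1; rewrite nE in s2; rewrite fE1 in s3; rewrite fE in s4.
have n1 : poch (a%:R + d%:R + 1/2) ((d.+1 + b)%:Z - (2 * d)%:Z) != 0.
  by rewrite poch_neq0 ?nE //; lra.
have n2 : poch (d%:R + 1) ((d.+1 + b)%:Z - (2 * d)%:Z - 1) != 0.
  by rewrite poch_neq0 ?nE1 //; lra.
have n3 : poch (a%:R + (d.+1 + b)%:R - d%:R + 1/2) f != 0.
  by rewrite poch_neq0 ?fE1 ?dbE //; lra.
have n4 : poch (a%:R + (d.+1 + c)%:R - d%:R) (- f%:Z) != 0.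
  by rewrite poch_neq0 ?fE ?dcE ?cE //; lra.
rewrite !evenvalS IH afac_ratio /eventerm.
rewrite {}s1 ?{}s2 ?{}s3 ?{}s4 -?[a.+1%:R]natr1 ?dbE ?dcE ?cE; try by [ring | lra].
rewrite dbE in n3; rewrite dcE cE in n4.
move: n1 n2 n3 n4 (evenval _ _ _ _) (afac _ _ _ _).
do 7?[match goal with |- context [poch ?x ?n] => move: (poch x n) => ? end].
move=> n1 n2 n3 n4 u v; rewrite /c.
case: e {c cE e0 dcE IH} => /=; rewrite ?addn0 ?addn1; field;
  repeat (apply/andP; split) => //; apply: lt0r_neq0; lra.
Qed.

(** At [a = 0] the ratio of binomial coefficients [(b+1)(c+1)/((b+c+1)(b+c+2))] has to appear. The
    product gives [(b+f+1)(c-f+1/2) = (b+c+1)(b+c+2)/4] in the denominator, which is the origin of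
    the powers of 4. *)
Lemma oddval_term a d b f (e : bool) :
  let c := (b + f + f + e)%N in
  oddval a d.+1 b c
  = oddval a d b.+1 c.+1 * (oddterm a (d.+1 + b) (d.+1 + c) d f%:Z / 4).
Proof.
move=> c.
have d0 := ler0n rat d; have b0 := ler0n rat b; have f0 := ler0n rat f.
have cE : c%:R = b%:R + f%:R + f%:R + (e : nat)%:R :> rat by rewrite !natrD.
have e0 := ler0n rat e.
have dbE : (d.+1 + b)%:R = d%:R + 1 + b%:R :> rat by rewrite natrD -natr1.
have dcE : (d.+1 + c)%:R = d%:R + 1 + c%:R :> rat by rewrite natrD -natr1.
pose m0 : int := (d.+1 + c)%:Z - (2 * d)%:Z.
have mE : m0%:~R = 1 + c%:R - d%:R :> rat by rewrite intr_sub2 dcE; ring.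
have mE1 : (m0 - 1)%:~R = c%:R - d%:R :> rat by rewrite intrB mE; ring.
have mE2 : (m0 - 2)%:~R = c%:R - d%:R - 1 :> rat by rewrite intrB mE; ring.
have fE : (- f%:Z)%:~R = - f%:R :> rat by rewrite mulrNz -pmulrn.
have fE1 : (f%:Z)%:~R = f%:R :> rat by rewrite -pmulrn.
have n1 : poch (d%:R + 1) (m0 - 1) != 0.
  by rewrite poch_neq0 ?mE1 ?cE //; lra.
elim: a => [|a IH].
  have n2 : poch (d%:R + 3/2) (m0 - 2) != 0.
    by rewrite poch_neq0 ?mE2 ?cE //; lra.
  have n3 : poch ((d.+1 + b)%:R - d%:R) f != 0.
    by rewrite poch_neq0 ?fE1 ?dbE //; lra.
  have n4 : poch ((d.+1 + c)%:R - d%:R - 1/2) (- f%:Z) != 0.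
    by rewrite poch_neq0 ?fE ?dcE ?cE //; lra.
  have s1 : poch (d%:R + 1) m0 = poch (d%:R + 1) (m0 - 1) * (c%:R + 1).
    rewrite -{1}(subrK 1 m0) poch_recr ?mE1; first by congr (_ * _); ring.
    by rewrite cE; lra.
  have s2 : poch (d%:R + 3/2) (m0 - 1)
      = poch (d%:R + 3/2) (m0 - 2) * (c%:R + 1/2).
    have -> : m0 - 1 = m0 - 2 + 1 by lia.
    rewrite poch_recr ?mE2; first by congr (_ * _); field.
    by rewrite cE; lra.
  have s3 := @poch_shiftE ((d.+1 + b)%:R - d%:R) ((d.+1 + b)%:R - d%:R + 1) f.
  have s4 := @poch_shiftE ((d.+1 + c)%:R - d%:R - 1/2)
    ((d.+1 + c)%:R - d%:R + 1/2) (- f%:Z).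
  rewrite fE1 dbE in s3; rewrite fE dcE cE in s4.
  rewrite /oddval !big_ord0 !mulr1 /oddterm !add0r -/m0 s1 s2.
  rewrite dbE dcE cE {}s3 ?{}s4; try by [field | lra].
  rewrite dbE in n3; rewrite dcE cE in n4.
  move: n1 n2 n3 n4; rewrite {s1 s2 mE mE1 mE2}.
  do 4?[match goal with |- context [poch ?x ?n] => move: (poch x n) => ? end].
  move=> n1 n2 n3 n4.
  rewrite !addSn !addnS !facS /c in n1 n2 n3 n4 *.
  move: (fac_neq0 b) (fac_neq0 (b + (b + f + f + e)))
    (fac_neq0 (b + f + f + e)).
  move: (fac b) (fac (b + f + f + e)) (fac (b + _)) => w1 w2 w3 n5 n6 n7.
  case: e {c cE e0 dcE m0} => /=; rewrite ?addn0 ?addn1; field;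
    repeat (apply/andP; split) => //; apply: lt0r_neq0; lra.
have a0 := ler0n rat a.
have s1 := @poch_shiftE (a%:R + d%:R + 1) (a.+1%:R + d%:R + 1) m0.
have s2 := @poch_shiftE (a%:R + d%:R + 3/2) (a.+1%:R + d%:R + 3/2) (m0 - 1).
have s3 := @poch_shiftE (a%:R + (d.+1 + b)%:R - d%:R + 1)
  (a.+1%:R + (d.+1 + b)%:R - d%:R + 1) f.
have s4 := @poch_shiftE (a%:R + (d.+1 + c)%:R - d%:R + 1/2)
  (a.+1%:R + (d.+1 + c)%:R - d%:R + 1/2) (- f%:Z).
rewrite mE cE in s1; rewrite mE1 cE in s2; rewrite fE1 in s3; rewrite fE in s4.
have n2 : poch (a%:R + d%:R + 3/2) (m0 - 1) != 0.
  by rewrite poch_neq0 ?mE1 ?cE //; lra.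
have n3 : poch (a%:R + (d.+1 + b)%:R - d%:R + 1) f != 0.
  by rewrite poch_neq0 ?fE1 ?dbE //; lra.
have n4 : poch (a%:R + (d.+1 + c)%:R - d%:R + 1/2) (- f%:Z) != 0.
  by rewrite poch_neq0 ?fE ?dcE ?cE //; lra.
rewrite !oddvalS IH bfac_ratio /oddterm -/m0.
rewrite {}s1 ?{}s2 ?{}s3 ?{}s4 -?[a.+1%:R]natr1 ?dbE ?dcE ?cE; try by [ring | lra].
rewrite dbE in n3; rewrite dcE cE in n4.
move: n1 n2 n3 n4 (oddval _ _ _ _) (bfac _ _ _ _).
do 8?[match goal with |- context [poch ?x ?n] => move: (poch x n) => ? end].
move=> n1 n2 n3 n4 u v; rewrite /c.
case: e {c cE e0 dcE IH m0 mE mE1 mE2} => /=; rewrite ?addn0 ?addn1; field;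
  repeat (apply/andP; split) => //; apply: lt0r_neq0; lra.
Qed.

Lemma evenval_prod a b c d : (d <= b)%N -> (b <= c)%N ->
  evenval a d (b - d) (c - d)
  = evenval a 0 b c * \prod_(k < d) eventerm a b c k ((c - b) %/ 2)%N%:Z.
Proof.
move=> db bc; elim: d db => [|d IH] db; first by rewrite big_ord0 mulr1 !subn0.
rewrite big_ord_recr /= mulrA -IH ?(ltnW db) //.
have := evenval_term a d (b - d.+1) ((c - b) %/ 2) (odd (c - b)).
have -> : (b - d.+1 + (c - b) %/ 2 + (c - b) %/ 2 + odd (c - b) = c - d.+1)%N by lia.
by rewrite /= !subnKC ?(leq_trans db) // !subnSK // (leq_trans db).
Qed.

Lemma oddval_prod a b c d : (d <= b)%N -> (b <= c)%N ->
  oddval a d (b - d) (c - d)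
  = oddval a 0 b c
    * ((4 ^+ d)^-1 * \prod_(k < d) oddterm a b c k ((c - b) %/ 2)%N%:Z).
Proof.
move=> db bc; elim: d db => [|d IH] db.
  by rewrite big_ord0 expr0 invr1 !mulr1 !subn0.
have := oddval_term a d (b - d.+1) ((c - b) %/ 2) (odd (c - b)).
have -> : (b - d.+1 + (c - b) %/ 2 + (c - b) %/ 2 + odd (c - b) = c - d.+1)%N by lia.
rewrite /= !subnKC ?(leq_trans db) // !subnSK // ?(leq_trans db) // => ->.
by rewrite IH ?(ltnW db) // big_ord_recr exprSr invfM /=; ring.
Qed.

Theorem theorem2p1 (a b c d : nat) :
  (d <= b)%N -> (b <= c)%N ->
  let f : int := Posz ((c - b) %/ 2)%N in
  ((M (HexD (2 * a) b c d))%:R / (M (Hex (2 * a) b c))%:R : rat)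
  = \prod_(k < d)
      (poch (k%:R + 1/2) (b%:Z - (2 * k)%:Z)
       * poch (a%:R + k%:R + 1) (b%:Z - (2 * k)%:Z - 1)
       * poch (b%:R - k%:R + 1/2) f
       * poch (c%:R - k%:R) (- f)
     / (poch (a%:R + k%:R + 1/2) (b%:Z - (2 * k)%:Z)
       * poch (k%:R + 1) (b%:Z - (2 * k)%:Z - 1)
       * poch (a%:R + b%:R - k%:R + 1/2) f
       * poch (a%:R + c%:R - k%:R) (- f)))
  /\
  ((M (HexD (2 * a).+1 b c d))%:R / (M (Hex (2 * a).+1 b c))%:R : rat)
  = (4 ^+ d)^-1 * \prod_(k < d)
      (poch (a%:R + k%:R + 1) (c%:Z - (2 * k)%:Z)
       * poch (k%:R + 3/2) (c%:Z - (2 * k)%:Z - 2)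
       * poch (b%:R - k%:R) f
       * poch (c%:R - k%:R - 1/2) (- f)
     / (poch (k%:R + 1) (c%:Z - (2 * k)%:Z - 1)
       * poch (a%:R + k%:R + 3/2) (c%:Z - (2 * k)%:Z - 1)
       * poch (a%:R + b%:R - k%:R + 1) f
       * poch (a%:R + c%:R - k%:R + 1/2) (- f))).
Proof.
move=> db bc f; have dc := leq_trans db bc.
rewrite mul2n -addnn !M_HexD !M_Hex.
have := mu_even a (b - d) (c - d) d; have := mu_odd a (b - d) (c - d) d.
have := mu_even a b c 0; have := mu_odd a b c 0.
rewrite !subnKC // !add0n => -> -> -> ->.
split; first by rewrite evenval_prod // mulrC mulKf // evenval_neq0.
by rewrite oddval_prod // mulrC mulKf // oddval_neq0.
Qed.
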